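(* Let $T=(1,3,6^k,3,1)$ with $k\ge 5$. There are exactly $65$ potential Jordan degree types for pairs $(A,\ell)$ with $A\in\mathrm{Gor}(T)$ and $\ell\in A_1$; equivalently, there are exactly $65$ potential rank matrices for $T$.
   Context: $\mathsf{k}$ is an infinite field of arbitrary characteristic, $R=\mathsf{k}[x,y,z]$ with the standard grading; $6^k$ means $6$ repeated $k$ times. $\mathrm{Gor}(T)$ is the family of graded Artinian Gorenstein (AG) quotients $A=R/I$ with Hilbert function $T=(t_0,\dots,t_j)$; $j$ is the socle degree and $s=\max_i t_i$. For a nonzero linear form $\ell\in A_1$, the rank matrix $M_{A,\ell}$ is the $(j+1)\times(j+1)$ upper triangular matrix (indices $0,\dots,j$) with $(u,v)$ entry, $u\le v$, the rank of $\ell^{v-u}:A_u\to A_v$. A potential rank matrix for $T$ is an upper triangular $(j+1)\times(j+1)$ matrix $M$ of non-negative integers, with rows and columns indexed by $0,\dots,j$, satisfying the known necessary conditions for rank matrices: (i) writing $H(i)=(M_{0,i},M_{1,i+1},\dots,M_{j-i,j})$ for the $i$-th diagonal, $H(0)=T$, $H(1)\ne 0$, and each $H(i)$ is either zero or the Hilbert function of a graded AG quotient of $R$ of socle degree $j-i$; (ii) each difference $H(i)-(0,H(i+1))$ is an O-sequence, i.e. zero or the Hilbert function of a standard graded algebra; (iii) in the upper triangular part, rows are non-increasing from left to right and columns are non-decreasing from top to bottom; (iv) $M_{u+1,v}+M_{u,v+1}\ge M_{u,v}+M_{u+1,v+1}$ whenever $0\le u<v<j$; (v) for all $u\le v$ with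 $t_u=t_v=s$, the entry $M_{u,v}$ depends only on $v-u$. The potential Jordan degree type associated with $M$ is the multiset of pairs $(p,\nu)$ (strings of length $p$ starting in degree $\nu$) in which $(v-u+1,u)$ has multiplicity $M_{u,v}+M_{u-1,v+1}-M_{u-1,v}-M_{u,v+1}$ for $0\le u\le v\le j$ (entries with indices out of range being $0$). This correspondence between potential rank matrices and potential Jordan degree types is one-to-one; for $M=M_{A,\ell}$ it gives the actual Jordan degree type of $(A,\ell)$, i.e. the lengths and initial degrees of the strings in a decomposition of $A$ into graded cyclic $\mathsf{k}[\ell]$-modules. *)

(* Defs.v *)
From mathcomp Require Import all_boot all_order all_algebra.
From mathcomp Require Import finmap multiset.
From mathcomp Require Import mpoly.

Set Implicit Arguments.
Unset Strict Implicit.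
Unset Printing Implicit Defensive.

Import GRing.Theory.
Local Open Scope ring_scope.

Definition infinite_field (F : fieldType) : Prop :=
  forall s : seq F, exists x : F, x \notin s.

(* [idealr_closed] includes [1 \notin I], so the quotient by I is nonzero.    *)
Definition homogeneous_ideal (F : fieldType) (n : nat)
    (I : {pred {mpoly F[n]}}) : Prop :=
  idealr_closed I /\
  (forall (p : {mpoly F[n]}) (d : nat), p \in I -> pihomog mdeg d p \in I).

(* h d = dim_F (R_d / I_d); the subspace U is the graded piece I_d. The number *)
(* of variables is positive because [dhomog] is a vectType only in that case. *)
Definition hilbert_function (F : fieldType) (n : nat)
    (I : {pred {mpoly F[n.+1]}}) (h : nat -> nat) : Prop :=
  forall d : nat, exists2 U : {vspace dhomog n.+1 F d},
    (forall p : dhomog n.+1 F d, (p \in U) = (mpoly_of_dhomog p \in I))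
    & (h d + \dim U)%N = \dim {: dhomog n.+1 F d}.

(* The class of p lies in the socle of R / I.                                 *)
Definition in_socle (F : fieldType) (n : nat) (I : {pred {mpoly F[n]}})
    (p : {mpoly F[n]}) : Prop :=
  forall i : 'I_n, 'X_i * p \in I.

(* R / I is graded Artinian Gorenstein of socle degree e: e is the largest    *)
(* degree in which R / I is nonzero, and the socle of R / I is a line.        *)
Definition graded_AG (F : fieldType) (n : nat) (I : {pred {mpoly F[n]}})
    (e : nat) : Prop :=
  [/\ homogeneous_ideal I,
      exists2 p : {mpoly F[n]}, p \is e.-homog & p \notin I,
      (forall (d : nat) (p : {mpoly F[n]}),
         (e < d)%N -> p \is d.-homog -> p \in I)
    & exists f : {mpoly F[n]},
        [/\ in_socle I f, f \notin I
          & forall g : {mpoly F[n]}, in_socle I g ->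
              exists c : F, g - c *: f \in I] ].

(* Finite sequences stand for Hilbert functions that vanish afterwards.       *)
Definition AG_sequence3 (F : fieldType) (e : nat) (h : seq nat) : Prop :=
  exists2 I : {pred {mpoly F[3]}},
    graded_AG I e & hilbert_function I (nth 0%N h).

(* A standard graded algebra is a quotient of a polynomial ring in n + 1      *)
(* variables by a homogeneous ideal; this includes F = F[x] / (x). The        *)
(* entries are integers because the predicate is applied to differences.      *)
Definition O_sequence (F : fieldType) (D : seq int) : Prop :=
  all (fun a => a == 0) D \/
  exists (n : nat) (I : {pred {mpoly F[n.+1]}}) (h : nat -> nat),
    [/\ homogeneous_ideal I, hilbert_function I h
      & forall d : nat, (h d)%:Z = D`_d].

Definition entry (n : nat) (M : 'M[nat]_n) (u v : nat) : nat :=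
  match insub u, insub v with
  | Some i, Some j => M i j
  | _, _ => 0%N
  end.

(* Row u - 1; needed because u.-1 is 0, not out of range, at u = 0.           *)
Definition entry_above (n : nat) (M : 'M[nat]_n) (u v : nat) : nat :=
  if u is u'.+1 then entry M u' v else 0%N.

Definition diagonal (n : nat) (M : 'M[nat]_n) (i : nat) : seq nat :=
  mkseq (fun u => entry M u (u + i)) (n - i).

(* H(i) - (0, H(i+1))                                                         *)
Definition diagonal_difference (n : nat) (M : 'M[nat]_n) (i : nat) : seq int :=
  mkseq (fun u => (nth 0%N (diagonal M i) u)%:Z
                  - (nth 0%N (0%N :: diagonal M i.+1) u)%:Z) (n - i).

(* Here size T = j + 1, where j is the socle degree.                          *)
Record potential_rank_matrix (F : fieldType) (T : seq nat)
    (M : 'M[nat]_(size T)) : Prop := PotentialRankMatrix {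
  prm_upper : forall u v : 'I_(size T), (v < u)%N -> M u v = 0%N;
  prm_diag0 : diagonal M 0 = T;
  prm_diag1 : has (fun a => a != 0%N) (diagonal M 1);
  prm_diagonal : forall i : nat, (i < size T)%N ->
    all (fun a => a == 0%N) (diagonal M i) \/
    AG_sequence3 F ((size T).-1 - i) (diagonal M i);
  prm_difference : forall i : nat, (i < size T)%N ->
    O_sequence F (diagonal_difference M i);
  prm_rows : forall u v v' : 'I_(size T),
    (u <= v)%N -> (v <= v')%N -> (M u v' <= M u v)%N;
  prm_columns : forall u u' v : 'I_(size T),
    (u <= u')%N -> (u' <= v)%N -> (M u v <= M u' v)%N;
  prm_exchange : forall u v : nat, (u < v)%N -> (v < (size T).-1)%N ->
    (entry M u v + entry M u.+1 v.+1 <= entry M u.+1 v + entry M u v.+1)%N;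
  prm_plateau : forall u v u' v' : 'I_(size T),
    (u <= v)%N -> (u' <= v')%N -> (v - u = v' - u')%N ->
    nth 0%N T u = \max_(t <- T) t -> nth 0%N T v = \max_(t <- T) t ->
    nth 0%N T u' = \max_(t <- T) t -> nth 0%N T v' = \max_(t <- T) t ->
    M u v = M u' v' }.
Arguments potential_rank_matrix F T M : clear implicits.

(* For a potential rank matrix the monotonicity and exchange conditions make  *)
(* the subtraction exact.                                                     *)
Definition string_multiplicity (n : nat) (M : 'M[nat]_n) (u v : nat) : nat :=
  ((entry M u v + entry_above M u v.+1)
   - (entry_above M u v + entry M u v.+1))%N.

(* The pair (p, nu) is a string of length p starting in degree nu.            *)
Definition jordan_degree_type (n : nat) (M : 'M[nat]_n) :
    multiset (nat * nat)%type :=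
  \big[@msetD _/@mset0 _]_(0 <= u < n) \big[@msetD _/@mset0 _]_(u <= v < n)
    msetn (string_multiplicity M u v) ((v - u).+1, u).

Definition potential_jordan_degree_type (F : fieldType) (T : seq nat)
    (J : multiset (nat * nat)%type) : Prop :=
  exists2 M : 'M[nat]_(size T),
    potential_rank_matrix F T M & J = jordan_degree_type M.

Definition has_exactly (X : eqType) (N : nat) (P : X -> Prop) : Prop :=
  exists s : seq X, [/\ uniq s, size s = N & forall x : X, x \in s <-> P x].

(* (1, 3, 6^k, 3, 1) *)
Definition T1361 (k : nat) : seq nat := [:: 1; 3]%N ++ nseq k 6 ++ [:: 3; 1]%N.

(* Main.v *)
From HB Require Import structures.
Require Import Defs.
From mathcomp Require Import all_boot all_order all_algebra.
From mathcomp Require Import finmap multiset mpoly zify ring.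

(** Write j = k + 3 for the socle degree and H(i) for the i-th diagonal of a
    potential rank matrix M of T = (1, 3, 6^k, 3, 1).

    Gorenstein Hilbert functions are symmetric and M is constant along the
    plateau of T, so H(i) = (c_i, a_i, s_i, ..., s_i, a_i, c_i): three sequences,
    the first three rows of M, determine M ([layer_matrix_of]).  Moreover c_i
    only records whether H(i) is zero, which for i <= k + 1 is visible on a_i.
    Hence M amounts to its profile: the states (a_i, s_i) for 0 < i < k and the
    four numbers a_k, a_(k+1), c_(k+2), c_(k+3) of the short diagonals.  Each
    condition on M relates at most three consecutive diagonals, so profiles are
    walks in a finite graph, followed by one of finitely many endings.

    To bound the number of walks, very little of Macaulay's theorem is needed:
    if D is the Hilbert function of a standard graded algebra, then
    D_(d+1) <= D_d as soon as d > 0 and D_d <= 1 ([hilbert_le1]), and D_1 = 2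
    forces D_2 <= 3 ([hilbert_two_variables]).  Applied to the differences
    H(i) - (0, H(i+1)), and combined with the monotonicity and exchange
    conditions, these facts make every walk stationary from the sixth diagonal
    on.  The number of walks with an ending is therefore independent of
    k >= 5, and a finite computation shows that it is 65 ([size_profiles]).

    Conversely every such walk comes from a potential rank matrix
    ([profile_matrix_potential]).  A second finite computation shows that along
    these walks each difference, when not zero, grows like a Hilbert function in
    two variables, which a monomial ideal of F[x, y] realizes
    ([O_sequence_two_variables]).  Each non-zero diagonal is
    (1, a, s, ..., s, a, 1) for one of seven pairs (a, s), possibly cut short in
    the middle; it is the Hilbert function of the Gorenstein algebra whose
    inverse system is the sum of the evaluations at s points of the projective
    plane that span a linear forms and impose independent conditions on conics
    ([AG_sequence_pair]).  The points are chosen among six points with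
    coordinates 0 and 1, which lie on no conic in any characteristic.

    Finally the multiplicities of a Jordan degree type are mixed second
    differences of the rank matrix, and summing them back recovers the matrix
    ([rank_matrix_of_jordan_type]); so there are 65 Jordan degree types too. *)

Set Implicit Arguments.
Unset Strict Implicit.
Unset Printing Implicit Defensive.

Import Order.TTheory GRing.Theory Num.Theory.
Local Open Scope ring_scope.

(** * Homogeneous polynomials *)

Lemma homog0_const (F : fieldType) (n : nat) (p : {mpoly F[n]}) :
  p \is 0.-homog -> p = (p@_0%MM)%:MP.
Proof.
move=> homp; apply/mpolyP => m; rewrite mcoeffC.
have [->|m0] := eqVneq m 0%MM; first by rewrite mulr1.
by rewrite mulr0 (dhomog_nemf_coeff homp) // mdeg_eq0.
Qed.

Lemma homog_variable (F : fieldType) (n : nat) (i : 'I_n) :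
  ('X_i : {mpoly F[n]}) \is 1.-homog.
Proof. by rewrite dhomogX /= mdeg1. Qed.

Lemma homog_mul_variable (F : fieldType) (n d : nat) (i : 'I_n) (p : {mpoly F[n]}) :
  p \is d.-homog -> 'X_i * p \is d.+1.-homog.
Proof. exact: (@dhomogM _ _ _ 1 _ d _ (homog_variable F i)). Qed.

Lemma mnm_split_variable (n : nat) (m : 'X_{1..n}) :
  m != 0%MM -> exists i, m = (U_(i) + (m - U_(i)))%MM.
Proof.
move=> m0; have [i mi] : exists i, (0 < m i)%N.
  apply/existsP; apply: contraR m0 => /existsPn m0; apply/eqP/mnmP => i.
  by rewrite mnm0E; apply/eqP; rewrite -leqn0 leqNgt m0.
exists i; rewrite addmC submK //; apply/mnm_lepP => l; rewrite mnm1E.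
by case: eqP => // <-; apply: mi.
Qed.

Lemma homog_pred_variables (F : fieldType) (n d : nat) (p : {mpoly F[n.+1]}) : p \is d.+1.-homog ->
  exists2 q : 'I_n.+1 -> {mpoly F[n.+1]},
    (forall i, q i \is d.-homog) & p = \sum_i 'X_i * q i.
Proof.
move=> homp.
have: forall s : seq 'X_{1..n.+1}, all (fun m => mdeg m == d.+1) s ->
    exists2 q : 'I_n.+1 -> {mpoly F[n.+1]}, (forall i, q i \is d.-homog)
    & \sum_(m <- s) p@_m *: 'X_[m] = \sum_i 'X_i * q i.
  elim=> [_|m s IHs /= /andP[degm /IHs [q homq Eq]]].
    exists (fun=> 0) => [i|]; first exact: rpred0.
    by rewrite big_nil big1 // => i _; rewrite mulr0.
  have [i Em] : exists i, m = (U_(i) + (m - U_(i)))%MM.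
    by apply: mnm_split_variable; rewrite -mdeg_eq0 (eqP degm).
  exists (fun l => (if l == i then p@_m *: 'X_[m - U_(i)] else 0) + q l).
    move=> l; apply: rpredD => //; case: eqP => _; last exact: rpred0.
    apply: rpredZ; rewrite dhomogX; move: degm; rewrite {1}Em mdegD mdeg1 //.
  rewrite big_cons Eq; under [RHS]eq_bigr do rewrite mulrDr.
  rewrite big_split /=; congr (_ + _).
  rewrite (bigD1 i) //= eqxx big1 ?addr0.
    by rewrite -scalerAr -mpolyXD -Em.
  by move=> l /negPf ->; rewrite mulr0.
move/(_ (msupp p)); rewrite -dhomogE => /(_ homp)[q homq Ep].
by exists q => //; rewrite [LHS]mpolyE.
Qed.

Lemma mcoeff_pihomog (F : fieldType) (n : nat) (p : {mpoly F[n]}) d m :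
  (pihomog mdeg d p)@_m = if mdeg m == d then p@_m else 0.
Proof.
rewrite {2}[p]mpolyE pihomogE raddf_sum /= big_mkcond /=.
rewrite raddf_sum /=; case: eqP => [<-|md].
  apply: eq_bigr => m' _; case: eqP => //; rewrite !mcoeffZ mcoeffX.
  by case: eqP => [->//|_]; rewrite mulr0.
rewrite big1 // => m' _; case: eqP => // degm'.
rewrite mcoeffZ mcoeffX; case: eqP => [Em|_]; last by rewrite mulr0.
by case: md; rewrite -Em.
Qed.

(** Multiplying by a form of degree d shifts homogeneous components by d. *)
Lemma pihomogMr (F : fieldType) (n : nat) (p q : {mpoly F[n]}) (d e : nat) :
  q \is d.-homog ->
  pihomog mdeg e (p * q) = if (d <= e)%N then pihomog mdeg (e - d) p * q else 0.
Proof.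
move=> homq; rewrite {1}(pihomog_partitionE (leqnn (msize p))) mulr_suml linear_sum.
have homc c : pihomog mdeg c p * q \is (c + d).-homog.
  by apply: dhomogM => //; apply: pihomogP.
case: leqP => [le_de|lt_ed]; last first.
  apply: big1 => c _; apply: (pihomog_ne0 _ (homc c)).
  by rewrite gtn_eqF // ltn_addl.
have [ltp|lep] := ltnP (e - d) (msize p).
  rewrite (bigD1 (Ordinal ltp)) //= big1 => [|c nc].
    by rewrite addr0 pihomog_dE //; have := homc (e - d)%N; rewrite subnK.
  apply: (pihomog_ne0 _ (homc c)); apply: contra nc => /eqP Ec.
  by apply/eqP/val_inj; rewrite /= -Ec addnK.
rewrite big1 => [|c _].
  suff -> : pihomog mdeg (e - d) p = 0 by rewrite mul0r.
  rewrite pihomogE big_seq_cond big1 // => m /andP[/msize_mdeg_lt ltm /eqP Em].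
  by move: ltm lep; rewrite Em => ltm /(leq_trans ltm); rewrite ltnn.
apply: (pihomog_ne0 _ (homc c)); apply: contraTneq (ltn_ord c) => Ec.
by rewrite -leqNgt (leq_trans lep) // -Ec addnK.
Qed.

(** * Hilbert functions of homogeneous quotients *)

Section HomogeneousQuotient.
Variables (F : fieldType) (n : nat) (I : {pred {mpoly F[n.+1]}}).
Hypothesis homI : homogeneous_ideal I.
Implicit Types (p q : {mpoly F[n.+1]}) (d e : nat).

Lemma ideal0 : 0 \in I. Proof. by case: homI => [[]]. Qed.
Lemma ideal1 : 1 \notin I. Proof. by case: homI => [[]]. Qed.

Lemma idealMl p q : q \in I -> p * q \in I.
Proof. by case: homI => [[I0 _ Icl] _] qI; rewrite -[p * q]addr0 Icl. Qed.

Lemma idealD p q : p \in I -> q \in I -> p + q \in I.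
Proof.
by case: homI => [[_ _ Icl] _] pI qI; rewrite -[p]mul1r Icl.
Qed.

Lemma idealZ (c : F) p : p \in I -> c *: p \in I.
Proof. by move=> pI; rewrite -mul_mpolyC idealMl. Qed.

Lemma idealN p : p \in I -> - p \in I.
Proof. by rewrite -scaleN1r; apply: idealZ. Qed.

Lemma idealB p q : p \in I -> q \in I -> p - q \in I.
Proof. by move=> pI qI; rewrite idealD ?idealN. Qed.

Lemma ideal_sum (T : finType) (f : T -> {mpoly F[n.+1]}) :
  (forall i, f i \in I) -> \sum_i f i \in I.
Proof.
by move=> fI; elim/big_rec: _ => [|i p _ pI]; rewrite ?ideal0 ?idealD.
Qed.

Lemma ideal_pihomog d p : p \in I -> pihomog mdeg d p \in I.
Proof. by case: homI => _; apply. Qed.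

(** Linear algebra in the quotient by I, phrased on representatives. *)
Definition spans_degree d m (c : 'I_m -> {mpoly F[n.+1]}) :=
  forall p, p \is d.-homog -> exists u : 'I_m -> F, p - \sum_i u i *: c i \in I.

Definition independent_mod m (c : 'I_m -> {mpoly F[n.+1]}) :=
  forall u : 'I_m -> F, \sum_i u i *: c i \in I -> forall i, u i = 0.

(** Expressing the independent family through the spanning one modulo I gives a
    coefficient matrix whose rows are independent. *)
Lemma independent_le_spanning d m m' (b : 'I_m -> {mpoly F[n.+1]})
    (c : 'I_m' -> {mpoly F[n.+1]}) :
  (forall i, b i \is d.-homog) -> independent_mod b -> spans_degree d c ->
  (m <= m')%N.
Proof.
move=> homb indb spanc.
have /fin_all_exists [A bA] : forall i, exists u : 'I_m' -> F,
    b i - \sum_j u j *: c j \in I by move=> i; apply: spanc.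
suff: row_free (\matrix_(i, j) A i j).
  by rewrite -row_leq_rank => /leq_trans->//; apply: rank_leq_col.
apply: inj_row_free => v vA0; apply/rowP => i; rewrite mxE.
apply: (indb (v 0)).
have -> : \sum_i v 0 i *: b i =
    \sum_i v 0 i *: (b i - \sum_j A i j *: c j).
  under [RHS]eq_bigr do rewrite scalerBr.
  rewrite sumrB; set S := (X in _ - X).
  suff -> : S = 0 by rewrite subr0.
  rewrite /S; under eq_bigr do rewrite scaler_sumr.
  rewrite exchange_big big1 // => j _.
  have /rowP/(_ j) := vA0; rewrite !mxE => vAj.
  transitivity ((\sum_k v 0 k * A k j) *: c j).
    by under eq_bigr do rewrite scalerA; rewrite -scaler_suml.
  suff -> : \sum_k v 0 k * A k j = 0 by rewrite scale0r.
  by rewrite -[RHS]vAj; apply: eq_bigr => k _; rewrite mxE.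
by apply: ideal_sum => k; apply: idealZ.
Qed.

Section HilbertFunction.
Variable h : nat -> nat.
Hypothesis hilb : hilbert_function I h.

(** The bridge from dimensions of graded pieces to polynomials: a basis of a
    complement of the degree d part of I is a basis of the quotient. *)
Lemma hilbert_basis d : exists b : 'I_(h d) -> {mpoly F[n.+1]},
  [/\ forall i, b i \is d.-homog, independent_mod b & spans_degree d b].
Proof.
have [U IU dimU] := hilb d; pose C := (U^C)%VS.
have dimC : \dim C = h d by rewrite dimv_compl -dimU addnK.
rewrite -dimC; exists (fun i => mpoly_of_dhomog (vbasis C)`_i); split.
- by move=> i; apply: dhomog_is_dhomog.
- move=> u uI i.
  pose w := \sum_i u i *: (vbasis C)`_i.
  have wU : w \in U.
    by rewrite IU /w linear_sum; under eq_bigr do rewrite linearZ.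
  have wC : w \in C.
    by apply: memv_suml => l _; apply/memvZ/vbasis_mem/mem_nth; rewrite size_tuple.
  have w0 : w = 0.
    by apply/eqP; rewrite -memv0 -(capv_compl U) memv_cap wU.
  exact: (freeP (basis_free (vbasisP C)) u w0).
- move=> p homp; pose p' := DHomog homp.
  have: p' \in (U + C)%VS by rewrite addv_complf memvf.
  case/memv_addP => v vU [w wC Ep].
  exists (fun i => coord (vbasis C) i w).
  have := coord_vbasis wC => Ew.
  have -> : \sum_(i < \dim C) coord (vbasis C) i w *: mpoly_of_dhomog (vbasis C)`_i
     = mpoly_of_dhomog w.
    rewrite [in RHS]Ew linear_sum; by apply: eq_bigr => i _; rewrite linearZ.
  have -> : p = mpoly_of_dhomog v + mpoly_of_dhomog w.
    by rewrite -[p]/(mpoly_of_dhomog p') Ep linearD.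
  by rewrite addrK -IU.
Qed.

Lemma hilbert_le_spanning d m (c : 'I_m -> {mpoly F[n.+1]}) :
  spans_degree d c -> (h d <= m)%N.
Proof.
have [b [homb indb _]] := hilbert_basis d.
exact: independent_le_spanning homb indb.
Qed.

Lemma hilbert_gt0 d p : p \is d.-homog -> p \notin I -> (0 < h d)%N.
Proof.
move=> homp pI; rewrite lt0n; apply: contraNneq pI => h0.
have [b [_ _ /(_ _ homp)[u]]] := hilbert_basis d.
move: b u; rewrite h0 => b u; by rewrite big_ord0 subr0.
Qed.

Lemma hilbert_degree0 : h 0 = 1%N.
Proof.
apply/eqP; rewrite eqn_leq (hilbert_gt0 (dhomog1 _ _) ideal1) andbT.
apply: (@hilbert_le_spanning 0 1 (fun=> 1)) => p homp.
exists (fun=> p@_0%MM); rewrite big_ord1 {1}(homog0_const homp).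
by rewrite alg_mpolyC subrr ideal0.
Qed.

Lemma hilbert_eq0 d : h d = 0%N -> h d.+1 = 0%N.
Proof.
move=> hd0; apply/eqP; rewrite -leqn0.
apply: (@hilbert_le_spanning _ 0 (fun=> 0)) => p /homog_pred_variables [q homq ->].
exists (fun=> 0); rewrite big_ord0 subr0; apply: ideal_sum => i; apply: idealMl.
by apply: contraPT hd0 => /(hilbert_gt0 (homq i)); case: (h d).
Qed.

(** If the quotient is a line in degree d > 0, that line is spanned by some
    product x q with x a variable.  A product y (x q) equals x (y q), and y q is
    a multiple of x q modulo I, so x (x q) spans the next degree. *)
Lemma hilbert_le1 d : (0 < d)%N -> (h d <= 1)%N -> (h d.+1 <= h d)%N.
Proof.
case: d => // d _; case hd: (h d.+1) => [|[|//]] _.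
  by rewrite (hilbert_eq0 hd).
have [b [homb indb spanb]] := hilbert_basis d.+1.
move: b homb indb spanb; rewrite hd => b homb indb spanb.
have [q homq Eb] := homog_pred_variables (homb 0).
have [i qI] : exists i, 'X_i * q i \notin I.
  apply/existsP/contraT => /existsPn qI.
  have: b 0 \in I by rewrite Eb; apply: ideal_sum => i; apply/negPn/qI.
  move=> bI; have := indb (fun=> 1) _ 0; rewrite big_ord1 scale1r bI.
  by move=> /(_ isT)/eqP; rewrite oner_eq0.
(* x q is not in I, so it spans the quotient in degree d as well as b 0 does. *)
have spanX p : p \is d.+1.-homog -> exists c, p - c *: ('X_i * q i) \in I.
  move=> homp; have [u uI] := spanb _ homp.
  have [v vI] := spanb _ (homog_mul_variable i (homq i)).
  rewrite big_ord1 in uI; rewrite big_ord1 in vI.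
  have v0 : v 0 != 0.
    by apply: contraNneq qI => v0; rewrite v0 scale0r subr0 in vI.
  exists (u 0 / v 0).
  have -> : p - u 0 / v 0 *: ('X_i * q i) =
    (p - u 0 *: b 0) - (u 0 / v 0) *: ('X_i * q i - v 0 *: b 0).
    by rewrite scalerBr scalerA divfK // opprB addrC addrA subrK addrC.
  by rewrite idealB // idealZ.
apply: (@hilbert_le_spanning _ 1 (fun=> 'X_i * ('X_i * q i))) => p.
case/homog_pred_variables => r homr ->.
have /fin_all_exists [c cI] : forall l, exists c,
    'X_l * r l - c *: ('X_i * ('X_i * q i)) \in I.
  move=> l; have [c1 c1I] := spanX _ (homr l).
  have [c2 c2I] := spanX _ (homog_mul_variable l (homq i)).
  exists (c1 * c2).
  have -> : 'X_l * r l - (c1 * c2) *: ('X_i * ('X_i * q i)) =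
     'X_l * (r l - c1 *: ('X_i * q i)) +
      c1 *: ('X_i * ('X_l * q i - c2 *: ('X_i * q i))).
    rewrite !mulrBr scalerBr -!scalerAr scalerA mulrCA.
    by rewrite [X in _ = _ + (X - _)](_ : _ = c1 *: ('X_l * ('X_i * q i))) ?addrA ?subrK // mulrCA.
  by rewrite idealD ?idealZ ?idealMl.
exists (fun=> \sum_l c l); rewrite big_ord1 scaler_suml -sumrB.
exact: ideal_sum.
Qed.

(** Two linear forms have only three products of degree two. *)
Lemma hilbert_two_variables : h 1 = 2%N -> (h 2 <= 3)%N.
Proof.
move=> h1; have [b [homb _ spanb]] := hilbert_basis 1.
move: b homb spanb; rewrite h1 => b homb spanb.
have spanb2 p : p \is 1.-homog ->
    exists u : F * F, p - (u.1 *: b 0 + u.2 *: b 1) \in I.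
  case/spanb => u; rewrite big_ord_recl big_ord1 => uI; exists (u 0, u 1).
  by rewrite (_ : 1 = lift ord0 ord0) //; apply/val_inj.
pose c (i : 'I_3) := [tuple b 0 * b 0; b 0 * b 1; b 1 * b 1]`_i.
apply: (@hilbert_le_spanning _ 3 c) => p /homog_pred_variables [q homq ->].
have /fin_all_exists [u uI] := fun i => spanb2 _ (homq i).
have /fin_all_exists [v vI] : forall i, exists v : F * F,
    'X_i - (v.1 *: b 0 + v.2 *: b 1) \in I.
  by move=> i; apply: spanb2; apply: homog_variable.
pose w i := [tuple (v i).1 * (u i).1; (v i).1 * (u i).2 + (v i).2 * (u i).1;
                   (v i).2 * (u i).2].
have wI i : 'X_i * q i - \sum_(j < 3) (w i)`_j *: c j \in I.
  rewrite (_ : _ - _ = 'X_i * (q i - ((u i).1 *: b 0 + (u i).2 *: b 1)) +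
    ((u i).1 *: b 0 + (u i).2 *: b 1) * ('X_i - ((v i).1 *: b 0 + (v i).2 *: b 1))).
    by rewrite idealD ?idealMl.
  rewrite !big_ord_recl big_ord0 /c /= -!mul_mpolyC !mpolyCD !mpolyCM.
  ring.
exists (fun j => \sum_i (w i)`_j).
under [X in _ - X]eq_bigr do rewrite scaler_suml.
rewrite exchange_big -sumrB; exact: ideal_sum.
Qed.

End HilbertFunction.
End HomogeneousQuotient.

(** * Symmetry of Gorenstein Hilbert functions *)

Section GorensteinSymmetry.
Variables (F : fieldType) (n : nat) (I : {pred {mpoly F[n.+1]}}) (e : nat).
Hypothesis agI : graded_AG I e.
Implicit Types (p q : {mpoly F[n.+1]}) (d : nat).

Let homI : homogeneous_ideal I. Proof. by case: agI. Qed.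

Lemma AG_top_in_socle p : p \is e.-homog -> in_socle I p.
Proof.
case: agI => _ _ top _ homp i; apply: (top e.+1) => //.
exact: homog_mul_variable.
Qed.

(** The socle is a line and contains the top degree, so a socle element of lower
    degree is a multiple of a top form modulo I; comparing degrees kills it. *)
Lemma AG_socle_low d p : (d < e)%N -> p \is d.-homog -> in_socle I p -> p \in I.
Proof.
case: agI => _ [t homt tI] _ [f [_ fI soc]] lt_de homp socp.
have [c tc] := soc _ (AG_top_in_socle homt); have [c' pc] := soc _ socp.
have c0 : c != 0 by apply: contraNneq tI => c0; rewrite c0 scale0r subr0 in tc.
have : p - (c' / c) *: t \in I.
  rewrite (_ : _ - _ = (p - c' *: f) - (c' / c) *: (t - c *: f)).
    by rewrite (idealB homI) // (idealZ homI).
  by rewrite scalerBr scalerA divfK // opprB addrA subrK.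
move/(ideal_pihomog homI d); rewrite linearB linearZ /= (pihomog_dE homp).
by rewrite (pihomog_ne0 _ homt) ?scaler0 ?subr0 // gtn_eqF.
Qed.

(** The multiplication pairing into the top degree has no kernel: a form killed
    by all forms of complementary degree is, by descending induction on its
    degree, killed by all variables, hence in the socle. *)
Lemma AG_nondegenerate d p : (d <= e)%N -> p \is d.-homog ->
  (forall q, q \is (e - d).-homog -> q * p \in I) -> p \in I.
Proof.
move=> le_de; move Er: (e - d)%N => r.
elim: r d le_de Er p => [|r IHr] d le_de Er p homp pI.
  by rewrite -[p]mul1r; apply: pI; apply: dhomog1.
apply: (@AG_socle_low d) => //; first by rewrite -subn_gt0 Er.
move=> i; apply: (IHr d.+1); rewrite ?subnS ?Er //; first by rewrite -subn_gt0 Er.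
  exact: homog_mul_variable.
by move=> q homq; rewrite mulrA [q * _]mulrC; apply/pI/homog_mul_variable.
Qed.

Variable h : nat -> nat.
Hypothesis hilb : hilbert_function I h.

(** The matrix of the pairing of degree d with degree e - d has independent
    rows, because the pairing is nondegenerate. *)
Lemma AG_hilbert_le d : (d <= e)%N -> (h d <= h (e - d))%N.
Proof.
move=> le_de; case: (agI) => _ _ _ [f [_ fI soc]].
have [b [homb indb _]] := hilbert_basis hilb d.
have [c [homc _ spanc]] := hilbert_basis hilb (e - d).
have /fin_all_exists [A AI] : forall i, exists a : 'I_(h (e - d)) -> F,
    forall j, b i * c j - a j *: f \in I.
  move=> i; apply: (fin_all_exists (P := fun j a => b i * c j - a *: f \in I)) => j.
  apply: soc; apply: AG_top_in_socle.
  by rewrite -(subnKC le_de); apply: (@dhomogM _ _ _ d _ (e - d)).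
suff: row_free (\matrix_(i, j) A i j).
  by rewrite -row_leq_rank => /leq_trans->//; apply: rank_leq_col.
apply: inj_row_free => v vA0; apply/rowP => i; rewrite mxE.
apply: (indb (v 0)); apply: (@AG_nondegenerate d) => //.
  by apply: rpred_sum => k _; apply: rpredZ; apply: homb.
have killc j : c j * (\sum_k v 0 k *: b k) \in I.
  have -> : c j * (\sum_k v 0 k *: b k) =
      \sum_k v 0 k *: (b k * c j - A k j *: f).
    under [RHS]eq_bigr do rewrite scalerBr scalerA.
    rewrite sumrB -scaler_suml.
    suff -> : \sum_k v 0 k * A k j = 0.
      rewrite scale0r subr0 mulr_sumr; apply: eq_bigr => k _.
      by rewrite -scalerAr mulrC.
    have /rowP/(_ j) := vA0; rewrite !mxE => vAj.
    by rewrite -[RHS]vAj; apply: eq_bigr => k _; rewrite mxE.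
  by apply: (ideal_sum homI) => k; apply: (idealZ homI).
move=> q /spanc [u uI].
rewrite -(subrK (\sum_j u j *: c j) q) mulrDl (idealD homI) //.
  by rewrite mulrC (idealMl homI).
rewrite mulr_suml; apply: (ideal_sum homI) => j.
by rewrite -scalerAl (idealZ homI).
Qed.

Lemma AG_hilbert_symmetric d : (d <= e)%N -> h (e - d) = h d.
Proof.
move=> le_de; apply/eqP; rewrite eqn_leq AG_hilbert_le // andbT.
by have := AG_hilbert_le (leq_subr d e); rewrite subKn.
Qed.

End GorensteinSymmetry.

(** * What O-sequences and Gorenstein sequences must satisfy *)

(** The part of Macaulay's bounds that the count relies on. *)
Lemma O_sequence_weak (F : fieldType) (D : seq int) : O_sequence F D ->
  exists h : nat -> nat, [/\ forall d, D`_d = (h d)%:Z,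
    forall d, (0 < d)%N -> (h d <= 1)%N -> (h d.+1 <= h d)%N
    & h 1 = 2%N -> (h 2 <= 3)%N].
Proof.
case=> [/allP D0|[n [I [h [homI hilb hD]]]]].
  exists (fun=> 0%N); split=> // d.
  have [ltd|led] := ltnP d (size D); last by rewrite nth_default.
  by apply/eqP/D0/mem_nth.
exists h; split=> [d|d|]; first by rewrite hD.
  exact: (hilbert_le1 homI hilb).
exact: (hilbert_two_variables homI hilb).
Qed.

(** Positivity up to the socle degree: a zero would propagate up to degree e,
    where symmetry gives the value 1. *)
Lemma AG_sequence_facts (F : fieldType) (e : nat) (h : seq nat) :
  AG_sequence3 F e h ->
  [/\ nth 0%N h 0 = 1%N, forall d, (d <= e)%N -> nth 0%N h (e - d) = nth 0%N h d
    & forall d, (d <= e)%N -> (0 < nth 0%N h d)%N].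
Proof.
case=> I agI hilb; have homI : homogeneous_ideal I by case: agI.
have h0 := hilbert_degree0 homI hilb.
have sym := AG_hilbert_symmetric agI hilb.
split=> // d le_de; rewrite lt0n; apply/eqP => hd0.
have: nth 0%N h (d + (e - d)) = 0%N.
  by elim: (e - d)%N => [|r IHr]; rewrite ?addn0 // addnS (hilbert_eq0 homI hilb).
by rewrite subnKC // -[e]subn0 sym // h0.
Qed.

(** * O-sequences from monomial ideals in two variables *)

(** All Hilbert functions below are computed this way: in degree d, the ideal is
    cut out by r linear functionals that admit a dual family of forms. *)
Lemma hilbert_of_dual_basis (F : fieldType) (n : nat) (I : {pred {mpoly F[n.+1]}})
    (d r : nat) (f : 'I_r -> {mpoly F[n.+1]} -> F) (q : 'I_r -> {mpoly F[n.+1]}) :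
  (forall i, scalar (f i)) -> (forall i, q i \is d.-homog) ->
  (forall i j, f i (q j) = (i == j)%:R) ->
  (forall p, p \is d.-homog -> (p \in I <-> forall i, f i p = 0)) ->
  exists2 U : {vspace dhomog n.+1 F d},
    (forall p : dhomog n.+1 F d, (p \in U) = (mpoly_of_dhomog p \in I))
    & (r + \dim U)%N = \dim {: dhomog n.+1 F d}.
Proof.
move=> flin homq fq kerf.
pose L0 (p : dhomog n.+1 F d) : 'rV[F]_r := \row_i f i (mpoly_of_dhomog p).
have L0lin : linear L0.
  by move=> c u v; apply/rowP => i; rewrite !mxE linearP flin.
pose L : {linear dhomog n.+1 F d -> 'rV[F]_r} :=
  HB.pack L0 (GRing.isLinear.Build F _ _ _ L0 L0lin).
exists (lker (linfun L)) => [p|].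
  rewrite memv_ker lfunE /=; apply/eqP/idP => [/rowP L0p|].
    apply/kerf; first exact: dhomog_is_dhomog.
    by move=> i; have := L0p i; rewrite !mxE.
  move/(kerf _ (dhomog_is_dhomog p)) => fp0; apply/rowP => i.
  by rewrite !mxE fp0.
rewrite -(limg_ker_dim (linfun L) fullv) capfv addnC; congr (_ + _)%N.
suff -> : limg (linfun L) = fullv by rewrite dimvf /dim /= mul1n.
apply/eqP; rewrite eqEsubv subvf /=; apply/subvP => v _.
pose w := \sum_i v 0 i *: (DHomog (homq i) : dhomog n.+1 F d).
suff -> : v = linfun L w by apply: memv_img; apply: memvf.
rewrite lfunE /w linear_sum; apply/rowP => j; rewrite summxE.
rewrite (bigD1 j) // big1 => [|i ij]; rewrite linearZ !mxE fq ?eqxx ?mulr1.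
  by rewrite [RHS]addr0.
by rewrite eq_sym (negPf ij) mulr0.
Qed.

Section MonomialIdeal.
Variables (F : fieldType) (D : nat -> nat).
Hypotheses (D0 : D 0 = 1%N) (Dle : forall d, (D d <= d.+1)%N)
  (Dgrowth : forall d, (D d <= d)%N -> (D d.+1 <= D d)%N).

(** In degree d exactly the monomials x^(d-b) y^b with b < D d survive.  The growth
    condition on D says that the complementary set of monomials is stable under
    multiplication by x; stability under y follows. *)
Definition lex_ideal : {pred {mpoly F[2]}} :=
  [pred p : {mpoly F[2]} | all (fun m : 'X_{1..2} => D (mdeg m) <= m ord_max)%N (msupp p)].

Lemma lex_idealP (p : {mpoly F[2]}) :
  reflect (forall m : 'X_{1..2}, (m ord_max < D (mdeg m))%N -> p@_m = 0) (p \in lex_ideal).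
Proof.
apply: (iffP allP) => [pD m ltm|pD m].
  by apply/eqP; apply: contraLR ltm; rewrite -mcoeff_msupp -leqNgt; apply: pD.
by rewrite mcoeff_msupp leqNgt; apply: contraNN => /pD ->.
Qed.

Lemma growth_le d c b : (b <= d)%N -> (D d <= b)%N -> (D (d + c) <= b)%N.
Proof.
move=> bd Ddb; elim: c => [|c IHc]; rewrite ?addn0 // addnS.
apply: (leq_trans (Dgrowth _) IHc).
by rewrite (leq_trans IHc) // (leq_trans bd) // leq_addr.
Qed.

Lemma lex_ideal_homogeneous : homogeneous_ideal lex_ideal.
Proof.
split; last first.
  move=> p d /lex_idealP pD; apply/lex_idealP => m ltm.
  by rewrite mcoeff_pihomog (pD _ ltm) if_same.
split; first by apply/lex_idealP => m _; rewrite mcoeff0.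
  apply/negP => /lex_idealP/(_ 0%MM); rewrite mdeg0 D0 mnm0E mcoeff1 eqxx.
  by move/(_ isT)/eqP; rewrite oner_eq0.
move=> a u v /allP uD /lex_idealP vD; apply/lex_idealP => m ltm.
rewrite mcoeffD (vD _ ltm) addr0; apply: memN_msupp_eq0.
apply: contraL ltm => /msuppM_le /allpairsP [[m1 m2] /= [_ /uD m2D ->]].
rewrite -leqNgt mdegD addnC mnmDE; apply: leq_trans (leq_addl _ _).
apply: growth_le => //; rewrite mdegE (bigD1 ord_max) //=; exact: leq_addr.
Qed.

Lemma lex_ideal_hilbert : hilbert_function lex_ideal D.
Proof.
move=> d; pose m (i : nat) : 'X_{1..2} :=
  [multinom (if l == ord_max then i else (d - i)%N) | l < 2].
have degm i : (i <= d)%N -> mdeg (m i) = d.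
  by move=> le_id; rewrite mdegE !big_ord_recl big_ord0 !mnmE /=; lia.
have mE (m' : 'X_{1..2}) : mdeg m' = d -> m' = m (m' ord_max).
  rewrite mdegE !big_ord_recl big_ord0 addn0 => Ed; apply/mnmP => i.
  rewrite mnmE; case: eqP => [->//|/eqP i_max].
  rewrite -Ed (_ : lift ord0 ord0 = ord_max) ?addnK; last exact: val_inj.
  by congr (m' _); apply: val_inj; case: i i_max => [[|[|]]].
have max_m i : m i ord_max = i by rewrite mnmE eqxx.
have le_d (i : 'I_(D d)) : (i <= d)%N by have := Dle d; have := ltn_ord i; lia.
apply: (@hilbert_of_dual_basis _ _ _ d (D d) (fun i p => p@_(m i)) (fun i => 'X_[m i])).
- by move=> i c u v; rewrite mcoeffD mcoeffZ.
- by move=> i; rewrite dhomogX /= degm.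
- move=> i j; rewrite mcoeffX; congr (_ %:R); congr nat_of_bool.
  apply/eqP/eqP => [Em|->//]; apply: val_inj.
  by rewrite /= -[LHS](max_m i) -[RHS](max_m j) Em.
- move=> p homp; split=> [/lex_idealP pD i|p0].
    by apply: pD; rewrite max_m degm.
  apply/lex_idealP => m' ltm'; have [Em|nm] := eqVneq (mdeg m') d; last first.
    exact: dhomog_nemf_coeff nm.
  by rewrite Em in ltm'; rewrite (mE _ Em); have := p0 (Ordinal ltm').
Qed.

End MonomialIdeal.

Lemma O_sequence_two_variables (F : fieldType) (D : seq nat) :
  nth 0%N D 0 = 1%N -> (forall d, (nth 0%N D d <= d.+1)%N) ->
  (forall d, (nth 0%N D d <= d)%N -> (nth 0%N D d.+1 <= nth 0%N D d)%N) ->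
  O_sequence F [seq x%:Z | x <- D].
Proof.
move=> D0 Dle Dgrowth; right; exists 1%N, (@lex_ideal F (nth 0%N D)), (nth 0%N D).
split; [exact: lex_ideal_homogeneous | exact: lex_ideal_hilbert |].
move=> d; have [ltd|led] := ltnP d (size D); first by rewrite (nth_map 0%N).
by rewrite !nth_default ?size_map.
Qed.

(** * Gorenstein ideals from inverse systems *)

Section InverseSystem.
Variables (F : fieldType) (n : nat) (phi : {mpoly F[n]} -> F) (e : nat).
Hypothesis phi_lin : scalar phi.
Variable t : {mpoly F[n]}.
Hypotheses (homt : t \is e.-homog) (phit : phi t != 0).
Implicit Types (p q : {mpoly F[n]}) (d : nat).

Let phi0 : phi 0 = 0.
Proof. by have := phi_lin (-1) 0 0; rewrite scaler0 addr0 mulN1r addNr. Qed.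
Let phiZD c p q : phi (c *: p + q) = c * phi p + phi q.
Proof. exact: phi_lin. Qed.
Let phiD p q : phi (p + q) = phi p + phi q.
Proof. by have := phiZD 1 p q; rewrite scale1r mul1r. Qed.
Let phiZ c p : phi (c *: p) = c * phi p.
Proof. by have := phiZD c p 0; rewrite !addr0 phi0 addr0. Qed.

(** The ideal with inverse system phi, where phi is read as a functional on forms
    of degree e.  Monomials of degree at most e suffice as multipliers, which
    makes membership a boolean. *)
Definition annihilator : {pred {mpoly F[n]}} :=
  [pred p : {mpoly F[n]} | [forall m : 'X_{1..n < e.+1},
     phi (pihomog mdeg e ('X_[m] * p)) == 0]].

Lemma annihilatorP p :
  p \in annihilator <-> forall q, phi (pihomog mdeg e (q * p)) = 0.
Proof.
split=> [/forallP pI q|pI]; last by apply/forallP => m; rewrite pI.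
rewrite [q]mpolyE mulr_suml; elim/big_rec: _ => [|m r _ phir].
  by rewrite linear0.
rewrite linearD -scalerAl linearZ phiZD phir addr0.
have [ltm|lem] := ltnP (mdeg m) e.+1.
  by have /eqP /= -> := pI (BMultinom ltm); rewrite mulr0.
by rewrite /= ['X_[m] * p]mulrC (@pihomogMr _ _ _ _ (mdeg m)) ?dhomogX // leqNgt lem /= phi0 mulr0.
Qed.

Lemma annihilator_homogP d p : (d <= e)%N -> p \is d.-homog ->
  p \in annihilator <-> forall q, q \is (e - d).-homog -> phi (q * p) = 0.
Proof.
move=> le_de homp; rewrite annihilatorP; split=> [pI q homq|pI q].
  by rewrite -(pI q) pihomog_dE // -(subnK le_de); apply: dhomogM.
by rewrite (pihomogMr _ _ homp) le_de pI //; apply: pihomogP.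
Qed.

Lemma annihilator_high d p : (e < d)%N -> p \is d.-homog -> p \in annihilator.
Proof.
move=> lt_ed homp; apply/annihilatorP => q.
by rewrite (pihomogMr _ _ homp) leqNgt lt_ed.
Qed.

Lemma annihilator_homogeneous : homogeneous_ideal annihilator.
Proof.
split; first split.
- by apply/annihilatorP => q; rewrite mulr0 linear0.
- apply/negP => /annihilatorP/(_ t)/eqP.
  by rewrite mulr1 pihomog_dE // (negPf phit).
- move=> a u v /annihilatorP uI /annihilatorP vI; apply/annihilatorP => q.
  by rewrite mulrDr mulrA linearD phiD uI vI addr0.
move=> p d /annihilatorP pI; apply/annihilatorP => q.
rewrite (pihomogMr _ _ (pihomogP _ d p)).
case: leqP => // le_de; have := pI (pihomog mdeg (e - d) q).
by rewrite [_ * p]mulrC (pihomogMr _ _ (pihomogP _ _ q)) leq_subr subKn // mulrC.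
Qed.

(** In the top degree the ideal is the kernel of phi, so the quotient is a line
    there; and a socle element is determined modulo the ideal by the value of phi
    on its top component, since every monomial multiplier other than 1 is
    divisible by a variable. *)
Lemma annihilator_AG : graded_AG annihilator e.
Proof.
have tI : t \notin annihilator.
  apply/negP => /annihilatorP/(_ 1)/eqP.
  by rewrite mul1r pihomog_dE // (negPf phit).
split; first exact: annihilator_homogeneous.
- by exists t.
- by move=> d p; apply: annihilator_high.
have socle_t : in_socle annihilator t.
  by move=> i; apply: (@annihilator_high e.+1) => //; apply: homog_mul_variable.
exists t; split=> // g socg.
exists (phi (pihomog mdeg e g) / phi t); apply/forallP => m.
set c := _ / _; rewrite mulrBr linearB -scalerAr linearZ /=.
have [m0|m0] := eqVneq (val m : 'X_{1..n}) 0%MM.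
  rewrite m0 mpolyX0 !mul1r (pihomog_dE homt) -scaleN1r addrC phiZD phiZ.
  by rewrite /c divfK // mulN1r addNr.
have [i Em] := mnm_split_variable m0.
have -> : 'X_[val m] = 'X_[val m - U_(i)] * 'X_i :> {mpoly F[n]}.
  by rewrite -mpolyXD addmC -Em.
have /annihilatorP Xt := socle_t i; have /annihilatorP Xg := socg i.
by rewrite -!mulrA -scaleN1r addrC phiZD phiZ Xt Xg !mulr0 addr0.
Qed.

End InverseSystem.

(** * Inverse systems of point evaluations *)

(** The points P impose r d conditions on forms of degree d: the first r d points
    have dual forms t d i, and vanishing there implies vanishing at all points. *)
Section Points.
Variables (F : fieldType) (n s e : nat) (P : 'I_s -> 'I_n.+1 -> F).
Variables (r : nat -> nat) (t : nat -> nat -> {mpoly F[n.+1]}).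
Hypotheses (s_gt0 : (0 < s)%N) (r_le : forall d, (r d <= s)%N)
  (homt : forall d i, t d i \is d.-homog)
  (dualt : forall d (i j : 'I_s), (i < r d)%N -> (j < r d)%N ->
     (t d i).@[P j] = (i == j)%:R)
  (vanish : forall d p, p \is d.-homog ->
     (forall i : 'I_s, (i < r d)%N -> p.@[P i] = 0) -> forall i, p.@[P i] = 0)
  (r_max : forall d, (d <= e)%N -> r (maxn d (e - d)) = s).
Implicit Types (p q : {mpoly F[n.+1]}) (d : nat).

Definition eval_sum p := \sum_i p.@[P i].

Lemma eval_sum_linear : scalar eval_sum.
Proof.
move=> c p q; rewrite /eval_sum mulr_sumr -big_split; apply: eq_bigr => i _.
by rewrite mevalD mevalZ.
Qed.

Let re : r e = s. Proof. by have := r_max (leq0n e); rewrite max0n subn0. Qed.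
Let i0 : 'I_s := Ordinal s_gt0.

Lemma eval_sum_dual d (j : 'I_s) p : r d = s ->
  eval_sum (p * t d j) = p.@[P j].
Proof.
move=> rd; rewrite /eval_sum (bigD1 j) //= big1 => [|k kj].
  by rewrite mevalM dualt ?rd // eqxx mulr1 addr0.
by rewrite mevalM dualt ?rd // eq_sym (negPf kj) mulr0.
Qed.

Lemma eval_sum_top : eval_sum (t e i0) != 0.
Proof. by rewrite -[t e i0]mul1r eval_sum_dual // meval1 oner_eq0. Qed.

Let I := annihilator eval_sum e.

Lemma points_AG : graded_AG I e.
Proof. exact: (annihilator_AG eval_sum_linear (homt e i0) eval_sum_top). Qed.

Lemma points_homogP d p : (d <= e)%N -> p \is d.-homog ->
  p \in I <-> forall q, q \is (e - d).-homog -> eval_sum (q * p) = 0.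
Proof. exact: (annihilator_homogP eval_sum_linear). Qed.

(** By [r_max], of two complementary degrees the larger one separates the points.
    In the other degree d a form is in the ideal exactly when it vanishes at all
    points, which is r d conditions; the larger degree is dual to this. *)
Lemma points_hilbert :
  hilbert_function I (fun d => if (d <= e)%N then r (minn d (e - d)) else 0%N).
Proof.
move=> d; case: leqP => [le_de|lt_ed]; last first.
  apply: (@hilbert_of_dual_basis _ _ _ d 0 (fun=> \0) (fun=> 0)); try by case.
  move=> p homp; split=> // _.
  exact: (annihilator_high eval_sum_linear lt_ed homp).
have r_ord d' (i : 'I_(r d')) : (i < s)%N by apply: leq_trans (r_le d').
pose c d' (i : 'I_(r d')) : 'I_s := Ordinal (r_ord d' i).
have [le_d|lt_d] := leqP d (e - d).
- have rs : r (e - d) = s by rewrite -(r_max le_de) (maxn_idPr le_d).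
  apply: (@hilbert_of_dual_basis _ _ _ d (r d) (fun i p => p.@[P (c d i)]) (t d)).
  + by move=> i a u v; rewrite mevalD mevalZ.
  + by [].
  + by move=> i j; rewrite (dualt (i := c d j) (j := c d i)) //= eq_sym.
  move=> p homp; rewrite (points_homogP le_de homp); split=> [pI i|p0 q homq].
    by rewrite -(eval_sum_dual (c d i) p rs) // mulrC pI.
  rewrite /eval_sum big1 // => i _; rewrite mevalM.
  rewrite (vanish homp) ?mulr0 // => j ltj.
  have := p0 (Ordinal ltj); congr (_.@[P _] = 0); exact: val_inj.
- have le_d := ltnW lt_d.
  have rs : r d = s by rewrite -(r_max le_de) (maxn_idPl le_d).
  set d' := (e - d)%N.
  apply: (@hilbert_of_dual_basis _ _ _ d (r d')
    (fun i p => eval_sum (t d' i * p)) (fun i => t d (c d' i))).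
  + by move=> i a u v; rewrite mulrDr -scalerAr eval_sum_linear.
  + by [].
  + move=> i j; rewrite eval_sum_dual //.
    by rewrite (dualt (i := c d' i) (j := c d' j)) //=.
  move=> p homp; rewrite (points_homogP le_de homp); split=> [pI i|p0 q homq].
    exact: pI.
  (* Only the values of q matter, and q' interpolates them at all the points. *)
  pose q' := \sum_(i < r d') q.@[P (c d' i)] *: t d' i.
  have qq' i : (q - q').@[P i] = 0.
    apply: (@vanish d') => [|j ltj]; first by rewrite rpredB // rpred_sum // => k _; rewrite rpredZ.
    rewrite mevalB /q' (big_morph _ (mevalD _) (meval0 _)).
    rewrite (bigD1 (Ordinal ltj)) // big1 => [|k kj].
      rewrite mevalZ (_ : c d' _ = j); last exact: val_inj.
      by rewrite dualt // eqxx mulr1 /= addr0 subrr.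
    rewrite mevalZ (dualt (i := c d' k)) //= -val_eqE /=.
    by move: kj; rewrite -val_eqE /= => /negPf ->; rewrite mulr0.
  have -> : eval_sum (q * p) = eval_sum (q' * p).
    by apply: eq_bigr => i _; rewrite !mevalM; congr (_ * _); apply/eqP; rewrite -subr_eq0 -mevalB qq'.
  rewrite /q' mulr_suml; elim/big_rec: _ => [|i u _ IHu].
    by rewrite /eval_sum big1 // => i _; rewrite meval0.
  by rewrite -scalerAl eval_sum_linear IHu p0 mulr0 addr0.
Qed.

End Points.

(** The coordinate points and the midpoints of the coordinate triangle.  No conic
    passes through all six, in any characteristic: a conic through the coordinate
    points is a combination of xy, xz and yz, and each midpoint detects one of
    these monomials. *)
Definition point_coords : seq (seq nat) :=
  [:: [:: 1; 0; 0]; [:: 0; 1; 0]; [:: 0; 0; 1];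
      [:: 1; 1; 0]; [:: 1; 0; 1]; [:: 0; 1; 1]]%N.

Definition coord_nat (l i : nat) : nat := nth 0%N (nth [::] point_coords l) i.

Section SixPoints.
Variable F : fieldType.

Definition six_points (l : nat) : 'I_3 -> F := fun i => (coord_nat l i)%:R.

Let x : {mpoly F[3]} := 'X_(inord 0).
Let y : {mpoly F[3]} := 'X_(inord 1).
Let z : {mpoly F[3]} := 'X_(inord 2).

(** Interpolation in degree d + 2 at the six points.  The monomial x^(d+1) y is
    the indicator of the midpoint (1, 1, 0); subtracting such indicators from
    x^(d+2) isolates the coordinate point (1, 0, 0). *)
Definition indicator (d l : nat) : {mpoly F[3]} :=
  nth 0 [:: x ^+ d.+2 - x ^+ d.+1 * y - x ^+ d.+1 * z;
            y ^+ d.+2 - x ^+ d.+1 * y - y ^+ d.+1 * z;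
            z ^+ d.+2 - x ^+ d.+1 * z - y ^+ d.+1 * z;
            x ^+ d.+1 * y; x ^+ d.+1 * z; y ^+ d.+1 * z] l.

Lemma indicator_homog d l : indicator d l \is d.+2.-homog.
Proof.
have homX (i : 'I_3) k : ('X_i : {mpoly F[3]}) ^+ k \is k.-homog.
  by rewrite -[k in k.-homog]mul1n; apply: dhomogMn; apply: homog_variable.
have homM (i j : 'I_3) : ('X_i : {mpoly F[3]}) ^+ d.+1 * 'X_j \is d.+2.-homog.
  rewrite -[d.+2]addn1; apply: dhomogM; [exact: homX | exact: homog_variable].
by do 6?[case: l => [|l]]; rewrite /indicator /= ?nth_nil ?rpredB ?homX ?homM ?rpred0.
Qed.

Lemma indicatorE d l l' : (l < 6)%N -> (l' < 6)%N ->
  (indicator d l).@[six_points l'] = (l == l')%:R.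
Proof.
have evalX (i : 'I_3) k : (('X_i : {mpoly F[3]}) ^+ k).@[six_points l'] =
    (coord_nat l' i)%:R ^+ k by rewrite rmorphXn /= mevalXU.
have evalM (i j : 'I_3) k : (('X_i : {mpoly F[3]}) ^+ k * 'X_j).@[six_points l'] =
    (coord_nat l' i)%:R ^+ k * (coord_nat l' j)%:R by rewrite mevalM evalX mevalXU.
have [ox oy oz] : [/\ (inord 0 : 'I_3) = 0%N :> nat, (inord 1 : 'I_3) = 1%N :> nat &
  (inord 2 : 'I_3) = 2%N :> nat] by split; apply: inordK.
have z1 k : (0 : F) ^+ k.+1 = 0 by rewrite exprS mul0r.
rewrite /indicator /x /y /z => ltl ltl'.
do 6?[case: l ltl => [|l] ltl] => //=; rewrite ?mevalB ?evalX ?evalM ?ox ?oy ?oz.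
all: clear evalX evalM.
all: do 6?[case: l' ltl' => [|l'] ltl'] => //.
all: by rewrite /coord_nat /= ?expr1n ?z1 ?mulr0 ?mul0r ?mulr1 ?subr0 ?subrr ?sub0r ?oppr0.
Qed.

(** The first three of the six points are the coordinate points. *)
Lemma linear_form_eval (p : {mpoly F[3]}) (v : 'I_3 -> F) : p \is 1.-homog ->
  p.@[v] = \sum_(i < 3) p.@[six_points i] * v i.
Proof.
case/homog_pred_variables => q homq ->.
have evalE (w : 'I_3 -> F) : (\sum_i 'X_i * q i).@[w] = \sum_i w i * (q i)@_0%MM.
  rewrite (big_morph _ (mevalD _) (meval0 _)); apply: eq_bigr => i _.
  by rewrite mevalM mevalXU {1}(homog0_const (homq i)) mevalC.
rewrite evalE; apply: eq_bigr => i _; rewrite evalE mulrC; congr (_ * _).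
rewrite !big_ord_recl big_ord0 /six_points /=.
case: i => [[|[|[|//]]] lti] /=; rewrite /coord_nat /= ?mul0r ?mul1r ?add0r ?addr0;
  congr ((q _)@_ _); exact: val_inj.
Qed.

End SixPoints.

(** For the pair (2, 3) the points have to be collinear; otherwise the first s
    points do, and the first a of them are coordinate points in every case. *)
Definition point_labels (a s : nat) : seq nat :=
  if (a, s) == (2, 3)%N then [:: 0; 1; 3]%N else iota 0 s.

(** The pairs (a, s) occurring as values of T-bounded Gorenstein sequences
    (1, a, s, ..., s, a, 1). *)
Definition gorenstein_pair (a s : nat) : bool :=
  (a, s) \in [:: (1, 1); (2, 2); (2, 3); (3, 3); (3, 4); (3, 5); (3, 6)]%N.

(** The side condition ensures that in every degree d <= e one of d and e - d is
    large enough for forms of that degree to separate the points: degree 2 always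
    is, degree 1 if the points are independent, degree 0 if there is one point. *)
Lemma AG_sequence_pair (F : fieldType) (a s e : nat) :
  gorenstein_pair a s -> (2 < e)%N || (a == s) && ((0 < e)%N || (s == 1%N)) ->
  AG_sequence3 F e (mkseq (fun d => nth s [:: 1; a] (minn d (e - d)))%N e.+1).
Proof.
move=> as_ok e_ok; pose r d := nth s [:: 1; a]%N d.
pose L := point_labels a s; pose P (i : 'I_s) := six_points F (nth 0%N L i).
pose t d i : {mpoly F[3]} := match d with
  | 0 => 1 | 1 => 'X_(inord i) | d.+2 => indicator F d (nth 0%N L i) end.
have facts : [&& (0 < s)%N, (a <= s)%N, (a <= 3)%N, uniq L, size L == s, all (ltn^~ 6) L,
    take a L == iota 0 a & all (fun l => all (fun i => (i < a) || (coord_nat l i == 0))%N (iota 0 3)) L].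
  by move: as_ok; rewrite /L; do 7?[case/predU1P => [[-> ->]|]].
case/and5P: facts => s_gt0 le_as le_a3 uniqL /and4P[/eqP sizeL /allP L6 /eqP takeL /allP Lcoord].
have r_le d : (r d <= s)%N by case: d => [|[|c]] //=; rewrite /r /= ?nth_nil.
have homt d i : t d i \is d.-homog.
  case: d => [|[|d]]; [exact: dhomog1|exact: homog_variable|exact: indicator_homog].
have nthL i : (i < a)%N -> nth 0%N L i = i.
  by move=> lti; rewrite -(nth_take _ lti) takeL nth_iota.
have dualt d (i j : 'I_s) : (i < r d)%N -> (j < r d)%N ->
     (t d i).@[P j] = (i == j)%:R.
  case: d => [|[|d]]; rewrite /r /=.
  - by rewrite !ltnS !leqn0 -val_eqE /= => /eqP -> /eqP ->; rewrite meval1.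
  - move=> lti ltj; rewrite mevalXU /P /six_points nthL // inordK; last exact: leq_trans le_a3.
    have := leq_trans lti le_a3; have := leq_trans ltj le_a3; rewrite -val_eqE /=.
    by case: (nat_of_ord i) => [|[|[|//]]]; case: (nat_of_ord j) => [|[|[|//]]].
  - move=> _ _; have lt6 (k : 'I_s) : (nth 0 L k < 6)%N by apply/L6/mem_nth; rewrite sizeL.
    by rewrite indicatorE // nth_uniq ?sizeL.
have vanish c (p : {mpoly F[3]}) : p \is c.-homog ->
     (forall i : 'I_s, (i < r c)%N -> p.@[P i] = 0) -> forall i, p.@[P i] = 0.
  case: c => [|[|c]]; rewrite /r /=; last by move=> _ p0 i; rewrite p0 ?nth_nil.
    move=> /homog0_const -> p0 i; have := p0 (Ordinal s_gt0) isT.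
    by rewrite !mevalC.
  move=> homp p0 i; rewrite (linear_form_eval _ homp) big1 // => l _.
  have [ltl|lel] := ltnP l a.
    have := p0 (Ordinal (leq_trans ltl le_as)) ltl.
    by rewrite /P /= nthL // => ->; rewrite mul0r.
  have /Lcoord/allP/(_ l) : nth 0%N L i \in L by rewrite mem_nth ?sizeL.
  rewrite mem_iota ltn_ord ltnNge lel => /(_ isT)/eqP.
  by rewrite /P /six_points => ->; rewrite mulr0.
have r_max d : (d <= e)%N -> r (maxn d (e - d)) = s.
  move=> le_de; have : (1 < maxn d (e - d))%N || ((a == s) && ((0 < maxn d (e - d))%N || (s == 1%N))).
    by move: e_ok; case: (a == s); case: (s == 1%N) => /=; lia.
  rewrite /r; case: (maxn _ _) => [|[|m]] //=; last by rewrite nth_nil.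
    by case/andP => _ /eqP.
  by case/andP => /eqP.
exists (annihilator (eval_sum P) e); first exact: (points_AG s_gt0 homt dualt r_max).
move=> d; have [U IU dimU] := points_hilbert r_le homt dualt vanish r_max d.
exists U => //; rewrite -dimU; congr (_ + _)%N.
have [le_de|lt_ed] := leqP d e; first by rewrite nth_mkseq.
by rewrite nth_default // size_mkseq.
Qed.

(** * Profiles and their enumeration *)

Local Open Scope nat_scope.

(** A state is the pair (a, s) of a diagonal (c, a, s, ..., s, a, c), with (0, 0)
    for the zero diagonal; an ending is (a_k, a_(k+1), c_(k+2), c_(k+3)). *)
Definition state : Type := (nat * nat)%type.
Definition ending : Type := (nat * nat * nat * nat)%type.

(** The entry c of the diagonal encoded by a state. *)
Definition nonzero (x : state) : nat := (0 < x.1).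

(** Necessary for D to be an O-sequence, see [O_sequence_weak]. *)
Definition weak_growth (D : seq nat) : bool :=
  [&& (nth 0 D 1 == 2) ==> (nth 0 D 2 <= 3)
    & sorted (fun p q => (p <= 1) ==> (q <= p)) (behead D)].

(** Sufficient for D to be an O-sequence, see [O_sequence_shape]. *)
Definition two_variable_shape (D : seq nat) : bool :=
  all (pred1 0) D ||
  [&& nth 0 D 0 == 1, nth 0 D 1 <= 2, nth 0 D 2 <= 3,
      (nth 0 D 1 == 2) || (nth 0 D 2 <= nth 0 D 1) & sorted geq (drop 2 D)].

(** Two consecutive diagonals y and z.  The list is the difference y - (0, z) with
    its run of equal entries s - s' shortened to a single one.  The predicate O
    stands for the O-sequence condition, so that one definition serves both the
    necessary and the sufficient version. *)
Definition step (O : seq nat -> bool) (y z : state) : bool :=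
  let: (a, s) := y in let: (a', s') := z in
  [&& a' <= a, s' <= s, a' <= s
    & O [:: nonzero y; a - nonzero z; s - a'; s - s'; a - a'; nonzero y - nonzero z]].

(** The exchange condition between three consecutive diagonals, at the three
    places where it does not repeat itself. *)
Definition exchange (x y z : state) : bool :=
  let: (a0, s0) := x in let: (a, s) := y in let: (a', s') := z in
  [&& nonzero y + a <= a0 + nonzero z, a + s <= s0 + a' & s + s <= s0 + s'].

(** The conditions involving the diagonals k to k + 3, which are
    (c1, b, b, c1), (c2, d, c2), (c3, c3) and (c4), where x and y are the states of
    the diagonals k - 2 and k - 1. *)
Definition ending_ok (O : seq nat -> bool) (x y : state) (t : ending) : bool :=
  let: (a0, s0) := x in let: (a, s) := y in let: (b, d, c3, c4) := t in
  let c1 : nat := 0 < b in let c2 : nat := 0 < d in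
  [&& [&& b <= a, b <= s, d <= b, c3 <= c2 & c4 <= c3],
      [&& O [:: nonzero y; a - c1; s - b; a - b; nonzero y - c1],
          O [:: c1; b - c2; b - d; c1 - c2],
          O [:: c2; d - c3; c2 - c3] & O [:: c3; c3 - c4]]
    & [&& nonzero y + a <= a0 + c1, a + s <= s0 + b, c1 + b <= a + c2,
          b + b <= s + d, c2 + d <= b + c3 & c3 + c3 <= d + c4]].

Definition states : seq state :=
  (0, 0) :: [seq (a, s) | a <- iota 1 3, s <- iota 1 6].
Definition endings : seq ending :=
  [seq (bd.1, bd.2, c.1, c.2) | bd <- [seq (b, d) | b <- iota 0 4, d <- iota 0 4],
     c <- [seq (c3, c4) | c3 <- iota 0 2, c4 <- iota 0 2]].

Definition next_states (x y : state) : seq state :=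
  [seq z <- states | step weak_growth y z && exchange x y z].
Definition next_endings (x y : state) : seq ending :=
  [seq t <- endings | ending_ok weak_growth x y t].
Definition start : state := (3, 6).
Definition first_states : seq state :=
  [seq z <- states | (0 < z.1) && step weak_growth start z].

(** The walks of length m continuing the consecutive states x, y, with an ending. *)
Fixpoint paths (m : nat) (x y : state) : seq (seq state * ending) :=
  if m is m'.+1 then
    [seq (z :: p.1, p.2) | z <- next_states x y, p <- paths m' y z]
  else [seq ([::], t) | t <- next_endings x y].

(** The first diagonal must not be zero, and the exchange condition has no
    instance centred at the main diagonal; this is why the first step is special.
    The states listed are those of the diagonals 1 to m + 1, so k = m + 2. *)
Definition profiles (m : nat) : seq (seq state * ending) :=
  [seq (z :: p.1, p.2) | z <- first_states, p <- paths m start z].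

Lemma states_uniq : uniq states. Proof. by []. Qed.

Lemma paths_uniq m x y : uniq (paths m x y).
Proof.
elim: m x y => [|m IHm] x y /=.
  by rewrite map_inj_uniq ?filter_uniq // => t t' [].
apply: allpairs_uniq_dep => [|z _|[z p] [z' p'] _ _ [-> E1 E2]].
- exact/filter_uniq/states_uniq.
- exact: IHm.
- by congr Tagged; case: p p' E1 E2 => ? ? [? ?] /= -> ->.
Qed.

Lemma profiles_uniq m : uniq (profiles m).
Proof.
apply: allpairs_uniq_dep => [|z _|[z p] [z' p'] _ _ [-> E1 E2]].
- exact/filter_uniq/states_uniq.
- exact: paths_uniq.
- by congr Tagged; case: p p' E1 E2 => ? ? [? ?] /= -> ->.
Qed.

Lemma mem_paths m x y w t :
  ((w, t) \in paths m x y) <->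
  [/\ size w = m,
      forall i, i < m -> nth start w i \in
        next_states (nth start (x :: y :: w) i) (nth start (x :: y :: w) i.+1)
    & t \in next_endings (nth start (x :: y :: w) m) (nth start (x :: y :: w) m.+1)].
Proof.
elim: m x y w t => [|m IHm] x y w t /=.
  split=> [/mapP [t' t't [-> ->]] //|[/size0nil -> _ tt]].
  by apply/mapP; exists t.
split=> [/allpairsPdep [z [[w' t'] [zin pin [-> ->]]]]|[]].
  have [<- Hi Ht] := (IHm _ _ _ _).1 pin; split=> // -[|i] //= lti; exact: Hi.
case: w => // z w [sz] Hi Ht; apply/allpairsPdep; exists z, (w, t).
split=> //; first exact: (Hi 0).
by apply/(IHm _ _ _ _).2; split=> // i lti; apply: (Hi i.+1).
Qed.

Lemma mem_profiles m w t :
  ((w, t) \in profiles m) <->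
  [/\ size w = m.+1, nth start w 0 \in first_states,
      forall i, i < m -> nth start w i.+1 \in
        next_states (nth start (start :: w) i) (nth start w i)
    & t \in next_endings (nth start (start :: w) m) (nth start w m)].
Proof.
split=> [/allpairsPdep [z [[w' t'] [zin pin [-> ->]]]]|[]].
  by have [<- Hi Ht] := (mem_paths _ _ _ _ _).1 pin; split.
case: w => // z w [sz] zin Hi Ht; apply/allpairsPdep; exists z, (w, t).
by split=> //; apply/(mem_paths _ _ _ _ _).2; case: sz.
Qed.

(** After at most n steps every walk from x, y repeats a state that can only be
    followed by itself. *)
Fixpoint stabilizes (n : nat) (x y : state) : bool :=
  (x == y) && (next_states y y == [:: y]) ||
  (if n is n'.+1 then all (stabilizes n' y) (next_states x y) else false).

Lemma stable_size m y : next_states y y = [:: y] ->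
  size (paths m y y) = size (next_endings y y).
Proof.
move=> Ey; elim: m => [|m IHm] /=; first by rewrite size_map.
by rewrite Ey /= cats0 size_map.
Qed.

(** A stationary walk can be prolonged in exactly one way, so its length does not
    influence the number of endings. *)
Lemma stabilizes_size n m x y : stabilizes n x y -> n <= m ->
  size (paths m x y) = size (paths n x y).
Proof.
elim: n m x y => [|n IHn] m x y; (case/orP=> [/andP[/eqP-> /eqP Ey] _|]);
  try by rewrite !stable_size.
  by [].
case: m => // m /allP stab lenm /=; rewrite !size_allpairs_dep.
by congr sumn; apply/eq_in_map => z /stab /IHn ->.
Qed.

(** The bound 3 is k = 5; for k = 4 some walks have not yet separated and the count
    is 61. *)
Lemma size_profiles m : 3 <= m -> size (profiles m) = 65.
Proof.
have stab : all (stabilizes 6 start) first_states by vm_compute.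
have [le6m|lt_m6] := leqP 6 m; last first.
  by case: m lt_m6 => [|[|[|[|[|[|]]]]]] // _ _; vm_compute.
transitivity (size (profiles 6)); last by vm_compute.
rewrite !size_allpairs_dep; congr sumn; apply/eq_in_map => z zin.
exact: stabilizes_size (allP stab _ zin) le6m.
Qed.

Definition gorenstein_state (x : state) : bool :=
  x \in [:: (0, 0); (1, 1); (2, 2); (2, 3); (3, 3); (3, 4); (3, 5); (3, 6)].

Definition strong_pair (x y : state) : bool :=
  step two_variable_shape x y && gorenstein_state y.

(** The necessary conditions used in the enumeration already imply the sufficient
    ones.  For a pair x, y this holds once the walk goes on: (3, 6), (3, 1) passes
    the necessary test for its difference and is excluded only as a dead end. *)
Lemma reachable_pairs_strong : exists S : seq (state * state),
  [/\ forall z, z \in first_states -> (start, z) \in S,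
      forall x y z, (x, y) \in S -> z \in next_states x y ->
        (y, z) \in S /\ strong_pair x y
    & forall x y t, (x, y) \in S -> t \in next_endings x y ->
        ending_ok two_variable_shape x y t /\ strong_pair x y].
Proof.
(* Seven rounds reach every pair of consecutive states of a walk. *)
pose S := iter 7 (fun l => undup (l ++ [seq (p.2, z) | p <- l, z <- next_states p.1 p.2]))
    [seq (start, z) | z <- first_states].
have S_first : all (fun z => (start, z) \in S) first_states by vm_compute.
have S_closed : all (fun p => all (fun z => ((p.2, z) \in S) && strong_pair p.1 p.2)
    (next_states p.1 p.2)) S by vm_compute.
have S_tail : all (fun p => all (fun t => ending_ok two_variable_shape p.1 p.2 t
    && strong_pair p.1 p.2) (next_endings p.1 p.2)) S by vm_compute.
exists S; move: S S_first S_closed S_tail => S /allP S1 /allP S2 /allP S3.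
split=> [//|x y z /S2/allP xyS /xyS /andP[]|x y t /S3/allP xyS /xyS /andP[]] //.
Qed.

Lemma profile_strong m w t : (w, t) \in profiles m ->
  let x i := nth start (start :: w) i in
  [/\ size w = m.+1, 0 < (x 1).1,
      forall i, i <= m -> strong_pair (x i) (x i.+1),
      forall i, i < m -> exchange (x i) (x i.+1) (x i.+2)
    & ending_ok two_variable_shape (x m) (x m.+1) t].
Proof.
case: reachable_pairs_strong => S [S1 S2 S3].
move=> /mem_profiles [sz w0 Hi Ht] x.
have reach i : i <= m -> (x i, x i.+1) \in S.
  elim: i => [_|i IHi ltim]; first exact: S1.
  by have [] := S2 _ _ _ (IHi (ltnW ltim)) (Hi i ltim).
have [Htail _] := S3 _ _ _ (reach m (leqnn m)) Ht.
split=> //; first by move: w0; rewrite mem_filter => /andP[/andP[]].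
- move=> i; rewrite leq_eqVlt => /predU1P[->|ltim].
    by have [] := S3 _ _ _ (reach m (leqnn m)) Ht.
  by have [] := S2 _ _ _ (reach i (ltnW ltim)) (Hi i ltim).
- by move=> i /Hi; rewrite mem_filter => /andP[/andP[]].
Qed.

(** * Matrices determined by three layers *)

Local Open Scope ring_scope.

Section Layers.
Variable k : nat.

Lemma size_T1361 : size (T1361 k) = k.+4.
Proof. by rewrite /T1361 size_cat size_cat size_nseq /=; lia. Qed.

Lemma nth_T1361 u : (u < k.+4)%N ->
  nth 0%N (T1361 k) u = (nth 6 [:: 1; 3] (minn u (k.+3 - u)))%N.
Proof.
move=> ltu; rewrite /T1361 nth_cat; case: u ltu => [|[|u]] ltu.
- by [].
- by rewrite (_ : minn _ _ = 1%N) //; lia.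
rewrite -[LHS]/(nth 0 (nseq k 6 ++ [:: 3; 1]) (u.+2 - 2))%N 2!subSS subn0 nth_cat size_nseq nth_nseq.
have [lt_uk|le_ku] := ltnP u k.
  have : (1 < minn u.+2 (k.+3 - u.+2))%N by lia.
  by case: (minn _ _) => [|[|r]] //=; rewrite nth_nil.
have [->|->] : u = k \/ u = k.+1 by lia.
  by rewrite subnn (_ : minn _ _ = 1%N) //; lia.
by rewrite subSnn (_ : minn _ _ = 0%N) //; lia.
Qed.

Lemma max_T1361 : (0 < k)%N -> \max_(t <- T1361 k) t = 6%N.
Proof.
move=> k0; apply/eqP; rewrite eqn_leq; apply/andP; split.
  by apply/bigmax_leqP_seq => t; rewrite !mem_cat mem_nseq !inE => + _;
     case/or3P => [/orP[]|/andP[_]|/orP[]] /eqP ->.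
by apply: (leq_bigmax_seq (F := fun t => t) 6) => //; rewrite !mem_cat mem_nseq k0 orbT.
Qed.

Lemma entry_default n (M : 'M[nat]_n) u v : ~~ ((u < n) && (v < n))%N -> entry M u v = 0%N.
Proof.
by rewrite /entry; case: insubP => // i ltu _; case: insubP => // j ltv _; rewrite ltu ltv.
Qed.

Lemma entryE n (M : 'M[nat]_n) (i j : 'I_n) : entry M i j = M i j.
Proof. by rewrite /entry !valK. Qed.

(** Entry (u, v) lies on layer min(2, u, j - v): layers 0, 1 and 2 carry the
    sequences c, a and s, each indexed by the diagonal v - u. *)
Definition depth (u v : nat) : nat := minn 2 (minn u (k.+3 - v)).

Definition layered (G : nat -> nat -> nat) (u v : nat) : nat :=
  if (u <= v < k.+4)%N then G (depth u v) (v - u)%N else 0%N.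

Definition layer_matrix (G : nat -> nat -> nat) : 'M[nat]_(size (T1361 k)) :=
  \matrix_(u, v) layered G u v.

Lemma entry_layer G u v : entry (layer_matrix G) u v = layered G u v.
Proof.
have [/andP[ltu ltv]|out] := boolP ((u < k.+4) && (v < k.+4))%N; last first.
  rewrite entry_default ?size_T1361 // /layered; case: ifP => // ?; lia.
rewrite -size_T1361 in ltu ltv.
by rewrite -[u]/(nat_of_ord (Ordinal ltu)) -[v]/(nat_of_ord (Ordinal ltv)) entryE mxE.
Qed.

Lemma nth_diagonal n (M : 'M[nat]_n) i u :
  nth 0%N (diagonal M i) u = if (u < n - i)%N then entry M u (u + i) else 0%N.
Proof.
case: ltnP => [ltu|leu]; first by rewrite nth_mkseq.
by rewrite nth_default // size_mkseq.
Qed.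

Lemma nth_diagonal_difference n (M : 'M[nat]_n) i u : (u < n - i)%N ->
  (diagonal_difference M i)`_u =
    (entry M u (u + i))%:Z - (entry_above M u (u + i))%:Z.
Proof.
move=> ltu; rewrite nth_mkseq // nth_diagonal ltu; congr (_ - Posz _).
case: u ltu => [|u] ltu //=; rewrite nth_diagonal ifT ?addnS //; lia.
Qed.

(** Layer d meets the diagonal i only if i + 2 d <= j; values of G beyond are
    arbitrary. *)
Lemma eq_layer_matrix G G' :
  (forall d i, d < 3 -> i + 2 * d <= k.+3 -> G d i = G' d i)%N ->
  layer_matrix G = layer_matrix G'.
Proof.
move=> eqG; apply/matrixP => u v; rewrite !mxE /layered.
by case: ifP => // uv; rewrite eqG // /depth; lia.
Qed.

End Layers.

(** The first three rows of the matrix with profile p, including the state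
    [start] of the main diagonal. *)
Definition profile_layer (p : seq state * ending) (d : nat) : nat -> nat :=
  let: (w, (b0, b1, b2, b3)) := p in
  nth 0%N (nth [::]
    [:: map nonzero (start :: w) ++ [:: nat_of_bool (0 < b0); nat_of_bool (0 < b1); b2; b3];
        map fst (start :: w) ++ [:: b0; b1];
        map snd (start :: w)]%N d).

Definition profile_matrix (k : nat) (p : seq state * ending) : 'M[nat]_(size (T1361 k)) :=
  layer_matrix k (profile_layer p).

Section ProfileLayer.
Variables (w : seq state) (b0 b1 b2 b3 : nat).
Let p : seq state * ending := (w, (b0, b1, b2, b3)).
Local Open Scope nat_scope.

Lemma profile_layer0 i : profile_layer p 0 i =
  if i <= size w then nonzero (nth start (start :: w) i)
  else nth 0 [:: nat_of_bool (0 < b0); nat_of_bool (0 < b1); b2; b3] (i - (size w).+1).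
Proof.
rewrite -[LHS]/(nth 0 (map nonzero (start :: w) ++ _) i) nth_cat size_map.
rewrite -[size (start :: w)]/(size w).+1 ltnS; case: (leqP i (size w)) => lei //.
by rewrite -[RHS](nth_map start 0 nonzero).
Qed.

Lemma profile_layer1 i : profile_layer p 1 i =
  if i <= size w then (nth start (start :: w) i).1 else nth 0 [:: b0; b1] (i - (size w).+1).
Proof.
rewrite -[LHS]/(nth 0 (map fst (start :: w) ++ _) i) nth_cat size_map.
rewrite -[size (start :: w)]/(size w).+1 ltnS; case: (leqP i (size w)) => lei //.
by rewrite -[RHS](nth_map start 0 fst).
Qed.

Lemma profile_layer2 i : i <= size w -> profile_layer p 2 i = (nth start (start :: w) i).2.
Proof.
by move=> lti; rewrite -[RHS](nth_map start 0 snd).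
Qed.

End ProfileLayer.

(** * Rank matrices have profiles *)

Section Necessary.
Variables (F : fieldType) (T : seq nat) (M : 'M[nat]_(size T)).
Hypothesis pM : potential_rank_matrix F T M.
Local Open Scope nat_scope.

Lemma entry_ord u v (ltu : u < size T) (ltv : v < size T) :
  entry M u v = M (Ordinal ltu) (Ordinal ltv).
Proof. exact: (entryE M (Ordinal ltu) (Ordinal ltv)). Qed.

Lemma entry_upper u v : v < u -> entry M u v = 0.
Proof.
move=> lt_vu; have [/andP[ltu ltv]|] := boolP ((u < size T) && (v < size T)).
  by rewrite (entry_ord ltu ltv) (prm_upper pM).
exact: entry_default.
Qed.

Lemma entry_row u v v' : u <= v -> v <= v' -> entry M u v' <= entry M u v.
Proof.
move=> le_uv le_vv'; have [ltv'|] := boolP (v' < size T); last first.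
  by move=> nv'; rewrite (entry_default _ (v := v')) // (negPf nv') andbF.
have ltv := leq_ltn_trans le_vv' ltv'; have ltu := leq_ltn_trans le_uv ltv.
by rewrite (entry_ord ltu ltv') (entry_ord ltu ltv) (prm_rows pM).
Qed.

Lemma entry_column u u' v : u <= u' -> u' <= v -> entry M u v <= entry M u' v.
Proof.
move=> le_uu' le_u'v; have [ltv|] := boolP (v < size T); last first.
  by move=> nv; rewrite (entry_default _ (v := v)) // (negPf nv) andbF.
have ltu' := leq_ltn_trans le_u'v ltv; have ltu := leq_ltn_trans le_uu' ltu'.
by rewrite (entry_ord ltu ltv) (entry_ord ltu' ltv) (prm_columns pM).
Qed.

(** What the Gorenstein condition gives for a diagonal, in terms of entries. *)
Lemma diagonal_dichotomy i : i < size T ->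
  (forall u, entry M u (u + i) = 0) \/
  [/\ entry M 0 i = 1,
      forall u, u + i < size T ->
        entry M ((size T).-1 - i - u) ((size T).-1 - u) = entry M u (u + i)
    & forall u, u + i < size T -> 0 < entry M u (u + i)].
Proof.
move=> lti; have nthd u : u + i < size T -> nth 0 (diagonal M i) u = entry M u (u + i).
  by move=> ltu; rewrite nth_diagonal ifT //; lia.
case: (prm_diagonal pM lti) => [/allP d0|/AG_sequence_facts [h0 sym pos]]; [left|right].
  move=> u; have [ltu|leu] := ltnP (u + i) (size T); last first.
    by apply: entry_default; rewrite [u + i < _]ltnNge leu andbF.
  by rewrite -nthd //; apply/eqP/d0/mem_nth; rewrite size_mkseq; lia.
split=> [|u ltu|u ltu]; first by rewrite -h0 nthd.
  by rewrite -nthd // -sym ?nthd; [congr (entry M _ _) | |]; lia.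
by rewrite -nthd //; apply: pos; lia.
Qed.

Lemma diagonal_growth i : i < size T ->
  exists h : nat -> nat, [/\
    forall u, u + i < size T -> entry M u (u + i) = h u + entry_above M u (u + i),
    forall d, 0 < d -> h d <= 1 -> h d.+1 <= h d
    & h 1 = 2 -> h 2 <= 3].
Proof.
move=> /(prm_difference pM)/O_sequence_weak [h [hE h_le1 h2]]; exists h; split=> // u ltu.
have := hE u; rewrite nth_diagonal_difference; last by lia.
by lia.
Qed.

End Necessary.

Section Profile.
Variables (F : fieldType) (k : nat).
Local Open Scope nat_scope.
Local Notation T := (T1361 k).

Lemma layered_at G u v d i : v = u + i -> v < k.+4 ->
  minn 2 (minn u (k.+3 - v)) = d -> layered k G u v = G d i.
Proof.
move=> -> ltv Ed; rewrite /layered leq_addr ltv /= /depth Ed.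
by rewrite addKn.
Qed.

Variable M : 'M[nat]_(size T).
Hypothesis (k5 : 5 <= k) (pM : potential_rank_matrix F T M).

Lemma T_diagonal_dichotomy i : i < k.+4 ->
  (forall u, entry M u (u + i) = 0) \/
  [/\ entry M 0 i = 1,
      forall u, u + i < k.+4 ->
        entry M (k.+3 - i - u) (k.+3 - u) = entry M u (u + i)
    & forall u, u + i < k.+4 -> 0 < entry M u (u + i)].
Proof.
have sT := size_T1361 k; have sT1 : (size T).-1 = k.+3 by rewrite sT.
move=> lti; have [|z|[M1 sym pos]] := diagonal_dichotomy pM (i := i).
- by rewrite sT.
- by left.
by right; split=> // u ltu; [rewrite -sT1 sym | rewrite pos]; rewrite ?sT.
Qed.

Definition layer_of (d i : nat) : nat := entry M d (d + i).

(** Near the last column symmetry applies, and in the middle both u and v lie on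
    the plateau of T. *)
Lemma entry_layer_of u v : entry M u v = layered k layer_of u v.
Proof.
have sT := size_T1361 k; rewrite /layered.
case: ifP => [/andP[le_uv ltv]|]; last first.
  move=> nuv; have [lt_vu|le_uv] := ltnP v u; first exact: (entry_upper pM).
  by apply: entry_default; rewrite sT; lia.
have [Ed|[Ed|Ed]] : depth k u v = u \/ depth k u v = k.+3 - v \/
    depth k u v = 2 /\ 2 <= u /\ 2 <= k.+3 - v by rewrite /depth; lia.
- by rewrite Ed /layer_of subnKC.
- rewrite Ed /layer_of.
  have [|z|[_ sym _]] := T_diagonal_dichotomy (i := v - u); first by lia.
    by rewrite z; have := z u; rewrite subnKC.
  have := sym u; rewrite subnKC // => <- //.
  by congr (entry M _ _); lia.
case: Ed => -> [le2u le2v]; rewrite /layer_of.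
have ltu : u < size T by rewrite sT; lia.
have ltv' : v < size T by rewrite sT.
have lt2 : 2 < size T by rewrite sT; lia.
have ltvu : 2 + (v - u) < size T by rewrite sT; lia.
rewrite (entry_ord M ltu ltv') (entry_ord M lt2 ltvu).
have T6 x : 2 <= x -> 2 <= k.+3 - x -> nth 0 T x = \max_(t <- T) t.
  move=> le2x le2x'; rewrite max_T1361; last by lia.
  rewrite nth_T1361; last by lia.
  have : 1 < minn x (k.+3 - x) by lia.
  by case: (minn _ _) => [|[|r]] //=; rewrite nth_nil.
by apply: (prm_plateau pM); try apply: T6; rewrite /=; lia.
Qed.

Lemma layer_matrix_of : M = layer_matrix k layer_of.
Proof.
by apply/matrixP => u v; rewrite -!entryE entry_layer_of entry_layer.
Qed.

Let c i := layer_of 0 i.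
Let a i := layer_of 1 i.
Let s i := layer_of 2 i.

Let val0 u v i : v = u + i -> v < k.+4 -> minn u (k.+3 - v) = 0 -> entry M u v = c i.
Proof. by move=> Ev ltv Ed; rewrite entry_layer_of (layered_at _ Ev ltv (d := 0)) //; lia. Qed.
Let val1 u v i : v = u + i -> v < k.+4 -> minn u (k.+3 - v) = 1 -> entry M u v = a i.
Proof. by move=> Ev ltv Ed; rewrite entry_layer_of (layered_at _ Ev ltv (d := 1)) //; lia. Qed.
Let val2 u v i : v = u + i -> v < k.+4 -> 1 < minn u (k.+3 - v) -> entry M u v = s i.
Proof. by move=> Ev ltv Ed; rewrite entry_layer_of (layered_at _ Ev ltv (d := 2)) //; lia. Qed.

Lemma layer_nonzero i :
  [/\ c i <= 1, i <= k.+1 -> c i = (0 < a i) :> nat & i < k -> (0 < s i) = (0 < a i)].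
Proof.
have sT := size_T1361 k.
have [lti|lei] := ltnP i k.+4; last first.
  split; try lia; by rewrite /c /layer_of entry_default // sT; lia.
have [z|[c1 _ pos]] := T_diagonal_dichotomy lti.
  by split; rewrite /c /a /s /layer_of ?z.
split; rewrite /c /a /s /layer_of ?add0n ?c1 // => lek.
  by rewrite pos //; lia.
by rewrite !pos //; lia.
Qed.

Lemma diagonal_differences i : i < k.+4 ->
  let D u := entry M u (u + i) - entry_above M u (u + i) in
  [/\ forall u, u + i < k.+4 -> entry_above M u (u + i) <= entry M u (u + i),
      forall u, 0 < u -> u + i < k.+3 -> D u <= 1 -> D u.+1 <= D u
    & D 1 = 2 -> 2 + i < k.+4 -> D 2 <= 3].
Proof.
have sT := size_T1361 k.
move=> lti D; have [|h [hE h_le1 h2]] := diagonal_growth pM (i := i); first by rewrite sT.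
have Dh u : u + i < k.+4 -> D u = h u by rewrite -sT => ltu; rewrite /D hE // addnK.
split=> [u ltu|u u0 ltu|D1 lt2]; first by rewrite -sT in ltu; rewrite hE // leq_addl.
  by rewrite !Dh //; [apply: h_le1 | lia..].
by rewrite Dh // h2 // -Dh //; lia.
Qed.

(** The entries of the difference of diagonals i and i + 1 sit in degrees
    1, 2, 3 to k + 1 - i, k + 2 - i and k + 3 - i; the long run is constant, so that
    consecutive entries of the shortened list are consecutive in the difference. *)
Lemma growth_below i : i.+1 < k ->
  [/\ a i.+1 <= a i, s i.+1 <= s i, a i.+1 <= s i &
   weak_growth [:: c i; a i - c i.+1; s i - a i.+1; s i - s i.+1;
                   a i - a i.+1; c i - c i.+1]].
Proof.
move=> lti; have [le_above D_le D2] := @diagonal_differences i ltac:(lia).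
have D1E : entry M 1 (1 + i) - entry_above M 1 (1 + i) = a i - c i.+1.
  by rewrite /= (@val1 _ _ i) ?(@val0 _ _ i.+1) //; lia.
have D2E : entry M 2 (2 + i) - entry_above M 2 (2 + i) = s i - a i.+1.
  by rewrite /= (@val2 _ _ i) ?(@val1 _ _ i.+1) //; lia.
have D3E u : 2 < u -> u + i < k.+2 ->
    entry M u (u + i) - entry_above M u (u + i) = s i - s i.+1.
  by case: u => // u lt2u ltu; rewrite /= (@val2 _ _ i) ?(@val2 _ _ i.+1) //; lia.
have D4E u : u + i = k.+2 ->
    entry M u (u + i) - entry_above M u (u + i) = a i - a i.+1.
  by case: u => [|u] Eu; rewrite /= (@val1 _ _ i) ?(@val1 _ _ i.+1) //; lia.
have D5E u : u + i = k.+3 ->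
    entry M u (u + i) - entry_above M u (u + i) = c i - c i.+1.
  by case: u => [|u] Eu; rewrite /= (@val0 _ _ i) ?(@val0 _ _ i.+1) //; lia.
split.
- rewrite -(@val1 (k.+1 - i) k.+2 i.+1) -?(@val1 (k.+2 - i) k.+2 i); try lia.
  by apply: (entry_column pM); lia.
- by rewrite -(@val2 2 (3 + i) i.+1) -?(@val2 3 (3 + i) i); try lia; apply: (entry_column pM); lia.
- by rewrite -(@val1 1 (2 + i) i.+1) -?(@val2 2 (2 + i) i); try lia; apply: (entry_column pM); lia.
rewrite /weak_growth /=; apply/andP; split.
  by apply/implyP => /eqP; rewrite -D1E -D2E => D1; apply: (D2 D1); lia.
apply/and5P; split=> //.
- by apply/implyP; rewrite -D1E -D2E; apply: (D_le 1); lia.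
- by apply/implyP; rewrite -D2E -(D3E 3) //; apply: (D_le 2); lia.
- apply/implyP; rewrite -(D3E (k.+1 - i)) -?(D4E (k.+2 - i)); try lia.
  by rewrite (_ : k.+2 - i = (k.+1 - i).+1); try apply: D_le; lia.
- apply/implyP; rewrite -(D4E (k.+2 - i)) -?(D5E (k.+3 - i)); try lia.
  by rewrite (_ : k.+3 - i = (k.+2 - i).+1); try apply: D_le; lia.
Qed.

Lemma weak_growth_diagonal i : i < k.+4 ->
  weak_growth (mkseq (fun u => entry M u (u + i) - entry_above M u (u + i)) (k.+4 - i)).
Proof.
move=> lti; have [_ D_le D2] := diagonal_differences lti.
apply/andP; split.
  apply/implyP; have [lt2|le2] := ltnP 2 (k.+4 - i); last first.
    by rewrite [nth 0 _ 2]nth_default ?size_mkseq.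
  by rewrite !nth_mkseq ?(ltnW lt2) // => /eqP D1; apply: (D2 D1); lia.
apply/(sortedP 0) => u; rewrite size_behead size_mkseq !nth_behead => ltu.
by rewrite !nth_mkseq; [apply/implyP; apply: (D_le u.+1)| |]; lia.
Qed.

Lemma T_exchange u v : u < v -> v < k.+3 ->
  entry M u v + entry M u.+1 v.+1 <= entry M u.+1 v + entry M u v.+1.
Proof. by move=> lt_uv ltv; apply: (prm_exchange pM) => //; rewrite size_T1361. Qed.

Lemma exchange_layer0 i : i <= k -> c i.+1 + a i.+1 <= a i + c i.+2.
Proof.
move=> lti; have := @T_exchange 0 i.+1 ltac:(lia) ltac:(lia).
by rewrite (@val0 0 i.+1 i.+1) ?(@val1 1 i.+2 i.+1) ?(@val1 1 i.+1 i) ?(@val0 0 i.+2 i.+2); lia.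
Qed.

Lemma exchange_layer1 i : i.+1 < k -> a i.+1 + s i.+1 <= s i + a i.+2.
Proof.
move=> lti; have := @T_exchange 1 i.+2 ltac:(lia) ltac:(lia).
by rewrite (@val1 1 i.+2 i.+1) ?(@val2 2 i.+3 i.+1) ?(@val2 2 i.+2 i) ?(@val1 1 i.+3 i.+2); lia.
Qed.

Lemma exchange_layer2 i : i.+2 < k -> s i.+1 + s i.+1 <= s i + s i.+2.
Proof.
move=> lti; have := @T_exchange 2 i.+3 ltac:(lia) ltac:(lia).
by rewrite (@val2 2 i.+3 i.+1) ?(@val2 3 i.+4 i.+1) ?(@val2 3 i.+3 i) ?(@val2 2 i.+4 i.+2); lia.
Qed.

Lemma exchange_tails :
  a k + a k <= s k.-1 + a k.+1 /\ c k.+2 + c k.+2 <= a k.+1 + c k.+3.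
Proof.
split.
  have := @T_exchange 1 k.+1 ltac:(lia) ltac:(lia).
  by rewrite (@val1 1 k.+1 k) ?(@val1 2 k.+2 k) ?(@val2 2 k.+1 k.-1) ?(@val1 1 k.+2 k.+1); lia.
have := @T_exchange 0 k.+2 ltac:(lia) ltac:(lia).
by rewrite (@val0 0 k.+2 k.+2) ?(@val0 1 k.+3 k.+2) ?(@val1 1 k.+2 k.+1) ?(@val0 0 k.+3 k.+3); lia.
Qed.

Definition profile_of : seq state * ending :=
  (mkseq (fun i => (a i.+1, s i.+1)) k.-1, (a k, a k.+1, c k.+2, c k.+3)).

Lemma layer_start : [/\ c 0 = 1, a 0 = 3 & s 0 = 6].
Proof.
have dT u : u < k.+4 -> entry M u u = nth 0 T u.
  move=> ltu; rewrite -[RHS](congr1 (fun t => nth 0 t u) (prm_diag0 pM)).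
  by rewrite nth_diagonal addn0 ifT // size_T1361 subn0.
rewrite /c /a /s /layer_of !addn0 !dT // !nth_T1361 //.
have -> : minn 1 (k.+3 - 1) = 1 by lia.
by have -> : minn 2 (k.+3 - 2) = 2 by lia.
Qed.

Lemma layer_decreasing i j : i <= j ->
  [/\ c j <= c i, a j <= a i & s j <= s i].
Proof. by move=> le_ij; split; apply: (entry_row pM); lia. Qed.

Lemma mem_states i : i < k -> (a i, s i) \in states.
Proof.
move=> lti; have [_ a0 s0] := layer_start; have [_] := layer_decreasing (leq0n i).
rewrite a0 s0 => le_a le_s; have [_ _ /(_ lti)] := layer_nonzero i.
rewrite in_cons; case: (posnP (a i)) => [->|a_gt0 s_gt0].
  by rewrite lt0n => /negbFE/eqP ->.
by rewrite allpairs_f ?orbT // mem_iota; lia.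
Qed.

Let nth_profile i : i < k -> nth start (start :: profile_of.1) i = (a i, s i).
Proof.
have [_ a0 s0] := layer_start; case: i => [|i] lti /=; first by rewrite a0 s0.
by rewrite nth_mkseq //; lia.
Qed.

Let size_profile : size profile_of.1 = k.-1.
Proof. by rewrite size_mkseq. Qed.

Lemma profile_matrix_of : M = profile_matrix k profile_of.
Proof.
rewrite {1}layer_matrix_of; apply: eq_layer_matrix => d i lt_d le_i.
have c_nz j : j <= k.+1 -> c j = (0 < a j) by move=> lej; have [_ ->] := layer_nonzero j.
have k1 : k.-1.+1 = k by lia.
case: d lt_d le_i => [|[|[|//]]] _ le_i.
- rewrite profile_layer0 size_profile k1; case: (leqP i k.-1) => [lei|lti].
    rewrite nth_profile; last by lia.
    by rewrite -/(c i) c_nz //; lia.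
  have [->|[->|[->|->]]] : i = k \/ i = k.+1 \/ i = k.+2 \/ i = k.+3 by lia.
  + by rewrite subnn /= -c_nz.
  + by rewrite subSnn /= -c_nz.
  + by rewrite -addn2 addKn.
  + by rewrite -addn3 addKn.
- rewrite profile_layer1 size_profile k1; case: (leqP i k.-1) => [lei|lti].
    by rewrite nth_profile //; lia.
  have [->|->] : i = k \/ i = k.+1 by lia.
  + by rewrite subnn.
  + by rewrite subSnn.
by rewrite profile_layer2 ?size_profile ?nth_profile //; lia.
Qed.

Let nonzero_c i : i < k -> nonzero (a i, s i) = c i.
Proof. by move=> lti; have [_ ->] := layer_nonzero i; rewrite // ltnW // ltnW. Qed.

(** The conditions on M restated for its layers are the ones that define the walks. *)
Lemma profile_of_in : profile_of \in profiles k.-2.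
Proof.
have stepX i : i.+1 < k -> step weak_growth (a i, s i) (a i.+1, s i.+1).
  move=> lti; have [le_a le_s le_as wg] := growth_below lti.
  rewrite /step le_a le_s le_as /= -/(nonzero (a i, s i)) -/(nonzero (a i.+1, s i.+1)).
  by rewrite !nonzero_c // ltnW.
have exchX i : i.+2 < k -> exchange (a i, s i) (a i.+1, s i.+1) (a i.+2, s i.+2).
  move=> lti; rewrite /exchange !nonzero_c //; last by lia.
  by rewrite exchange_layer0 ?exchange_layer1 ?exchange_layer2 //; lia.
rewrite /profile_of; apply/mem_profiles; split.
- by rewrite size_mkseq; lia.
- rewrite nth_mkseq; last by lia.
  rewrite mem_filter mem_states ?andbT; last by lia.
  have [_ a0 s0] := layer_start; have := stepX 0 ltac:(lia); rewrite a0 s0 => -> /=.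
  have [z|[_ _ pos]] := T_diagonal_dichotomy (i := 1) isT; last by rewrite andbT pos //; lia.
  have := prm_diag1 pM; case/(has_nthP 0) => u; rewrite size_mkseq => ltu.
  by rewrite nth_diagonal ltu z.
- move=> i lti; have := nth_profile (i := i) ltac:(lia); rewrite /= => ->.
  rewrite !nth_mkseq; [|lia..].
  by rewrite mem_filter stepX ?exchX ?mem_states //; lia.
have [exch_k exch_k2] := exchange_tails.
have := nth_profile (i := k.-2) ltac:(lia); rewrite /= => ->; rewrite nth_mkseq; last by lia.
have -> : k.-2.+1 = k.-1 by lia.
have c_nz j : j <= k.+1 -> nat_of_bool (0 < a j) = c j by move=> lej; have [_ ->] := layer_nonzero j.
have [[c2 _ _] [c3 _ _]] := (layer_nonzero k.+2, layer_nonzero k.+3).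
have [_ a0 _] := layer_start.
have [_ a_le _] := layer_decreasing (leq0n k); have [_ a_le1 _] := layer_decreasing (leq0n k.+1).
rewrite mem_filter andbC; apply/andP; split.
  apply/allpairsP; exists ((a k, a k.+1), (c k.+2, c k.+3)); split=> //;
    apply/allpairsP.
    by exists (a k, a k.+1); split=> //; rewrite mem_iota /=; lia.
  by exists (c k.+2, c k.+3); split=> //; rewrite mem_iota /=; lia.
have [_ ak_le _] := layer_decreasing (leq_pred k).
have [_ ak1_le _] := layer_decreasing (leqnSn k).
have [c2_le _ _] := layer_decreasing (leqnSn k.+1).
have [c3_le _ _] := layer_decreasing (leqnSn k.+2).
have as_le : a k <= s k.-1.
  rewrite -(@val1 1 k.+1 k) -?(@val2 2 k.+1 k.-1); try lia.
  by apply: (entry_column pM); lia.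
rewrite /ending_ok !c_nz ?nonzero_c; try lia.
rewrite ak_le as_le ak1_le c2_le c3_le exch_k exch_k2 /=.
have Dval u i d j d' : u.+1 + i < k.+4 -> minn 2 (minn u.+1 (k.+3 - (u.+1 + i))) = d ->
    minn 2 (minn u (k.+3 - (u.+1 + i))) = d' -> j = i.+1 ->
    entry M u.+1 (u.+1 + i) - entry_above M u.+1 (u.+1 + i) =
    layer_of d i - layer_of d' j.
  move=> ltu Ed Ed' ->; rewrite /= entry_layer_of (layered_at _ (erefl _) ltu Ed).
  by rewrite entry_layer_of (layered_at _ (addSnnS u i) ltu Ed').
have wg q n (leq : q < k.+4) : k.+4 - q = n.+1 ->
    weak_growth (c q :: [seq layer_of (minn 2 (minn u (n - u))) q -
       layer_of (minn 2 (minn u.-1 (n - u))) q.+1 | u <- iota 1 n]).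
  move=> En; have := weak_growth_diagonal leq; rewrite En /mkseq /=.
  rewrite subn0 /c /layer_of add0n; congr (weak_growth (_ :: _)).
  apply/eq_in_map => -[|u]; rewrite mem_iota // => /andP[_ ltu].
  by apply: Dval; try (congr (minn _ _)); lia.
have kp : k.-1.+1 = k by lia.
have wg1 : weak_growth [:: c k.-1; a k.-1 - c k.-1.+1; s k.-1 - a k.-1.+1;
    a k.-1 - a k.-1.+1; c k.-1 - c k.-1.+1] := wg k.-1 4 ltac:(lia) ltac:(lia).
have wg2 : weak_growth [:: c k; a k - c k.+1; a k - a k.+1; c k - c k.+1] :=
  wg k 3 ltac:(lia) ltac:(lia).
have wg3 : weak_growth [:: c k.+1; a k.+1 - c k.+2; c k.+1 - c k.+2] :=
  wg k.+1 2 ltac:(lia) ltac:(lia).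
rewrite kp in wg1; rewrite wg1 wg2 wg3 /=.
have := exchange_layer0 (i := k.-2) ltac:(lia).
have := exchange_layer0 (i := k.-1) ltac:(lia).
have := exchange_layer0 (leqnn k).
have := exchange_layer1 (i := k.-2) ltac:(lia).
rewrite (_ : k.-2.+1 = k.-1) ?kp ?(_ : k.-2.+2 = k); try lia.
by move=> -> -> -> ->; rewrite /weak_growth /= implybT.
Qed.

End Profile.

(** * Profiles give rank matrices *)

(** Being non-increasing from degree 2 on with D 2 <= 3 covers the remaining bounds
    of [O_sequence_two_variables]. *)
Lemma O_sequence_shape (F : fieldType) (D : seq nat) :
  two_variable_shape D -> O_sequence F [seq x%:Z | x <- D].
Proof.
case/orP => [/allP D0|/and5P[/eqP D0 D1 D2 D12 Dsort]].
  by left; apply/allP => _ /mapP[x /D0 /eqP -> ->].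
have Dmono d : (1 < d)%N -> (nth 0%N D d.+1 <= nth 0%N D d)%N.
  case: d => [|[|d]] // _.
  have [lt|le] := ltnP d.+3 (size D); last by rewrite nth_default.
  have := sorted_leq_nth (rev_trans leq_trans) leqnn 0%N Dsort.
  move=> /(_ d d.+1); rewrite !inE !size_drop !nth_drop !add2n; apply=> //; lia.
apply: O_sequence_two_variables => // [d|d].
  case: d => [|[|d]] //; first by rewrite D0.
  suff: (nth 0%N D d.+2 <= 3)%N by lia.
  by elim: d => // d; apply: leq_trans; apply: Dmono.
case: d => [|[|d]] led; [by rewrite D0 in led | | exact: Dmono].
by case/orP: D12 => [/eqP E|//]; rewrite E in led.
Qed.

Local Open Scope nat_scope.

(** Restores the run of equal entries that [step] shortens. *)
Lemma shape_insert m x0 x1 x2 q r :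
  two_variable_shape [:: x0, x1, x2, q & r] ->
  two_variable_shape [:: x0, x1, x2 & nseq m.+1 q ++ r].
Proof.
rewrite /two_variable_shape => /orP [z|/and5P[h0 h1 h2 h12 hs]]; apply/orP.
  by left; move: z => /=; rewrite all_cat all_nseq => /and5P[-> -> -> q0 ->]; rewrite q0 /= ?q0 orbT.
right; apply/and5P; split=> //; move: hs; rewrite /= => /andP[->] /=.
elim: m => //= m IHm hs; rewrite IHm // andbT.
by rewrite /geq /= leqnn.
Qed.

Lemma stepE O y z : step O y z = [&& z.1 <= y.1, z.2 <= y.2, z.1 <= y.2
  & O [:: nonzero y; y.1 - nonzero z; y.2 - z.1; y.2 - z.2; y.1 - z.1; nonzero y - nonzero z]].
Proof. by case: y z => a s [a' s']. Qed.

Lemma exchangeE x y z : exchange x y z =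
  [&& nonzero y + y.1 <= x.1 + nonzero z, y.1 + y.2 <= x.2 + z.1 & y.2 + y.2 <= x.2 + z.2].
Proof. by case: x y z => a0 s0 [a s] [a' s']. Qed.

Section Sufficient.
Variables (F : fieldType) (k : nat) (k5 : 5 <= k).
Variables (w : seq state) (b0 b1 b2 b3 : nat).
Let p : seq state * ending := (w, (b0, b1, b2, b3)).
Hypothesis pP : p \in profiles k.-2.
Local Notation T := (T1361 k).

Let G := profile_layer p.
Let x i := nth start (start :: w) i.
Let c i := G 0 i.
Let a i := G 1 i.
Let s i := G 2 i.

Let size_w : size w = k.-1.
Proof. by have [-> _ _ _ _] := profile_strong pP; lia. Qed.

Let cE i : i < k -> c i = nonzero (x i).
Proof. by move=> lti; rewrite /c /G profile_layer0 size_w ifT //; lia. Qed.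
Let aE i : i < k -> a i = (x i).1.
Proof. by move=> lti; rewrite /a /G profile_layer1 size_w ifT //; lia. Qed.
Let sE i : i < k -> s i = (x i).2.
Proof. by move=> lti; rewrite /s /G profile_layer2 // size_w; lia. Qed.

Let tailE : [/\ c k = (0 < b0), c k.+1 = (0 < b1), c k.+2 = b2 & c k.+3 = b3]
  /\ (a k = b0 /\ a k.+1 = b1).
Proof.
have kp : k.-1.+1 = k by lia.
split; first split; last split.
- by rewrite /c /G profile_layer0 size_w kp subnn ifF //; lia.
- by rewrite /c /G profile_layer0 size_w kp subSnn ifF //; lia.
- by rewrite /c /G profile_layer0 size_w kp -addn2 addKn ifF //; lia.
- by rewrite /c /G profile_layer0 size_w kp -addn3 addKn ifF //; lia.
- by rewrite /a /G profile_layer1 size_w kp subnn ifF //; lia.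
- by rewrite /a /G profile_layer1 size_w kp subSnn ifF //; lia.
Qed.

Let c_pos i : i <= k.+1 -> c i = (0 < a i).
Proof.
move=> lei; have [[ck ck1 _ _] [ak ak1]] := tailE.
have [lti|] := ltnP i k; first by rewrite cE // aE.
move=> lek; have [->|->] : i = k \/ i = k.+1 by lia.
  by rewrite ck ak.
by rewrite ck1 ak1.
Qed.

Definition layer_shape (i : nat) : Prop :=
  [/\ a i.+1 <= a i, s i.+1 <= s i, a i.+1 <= s i
  & two_variable_shape [:: c i; a i - c i.+1; s i - a i.+1; s i - s i.+1;
                           a i - a i.+1; c i - c i.+1]].

Let inner_shape i : i.+1 < k -> layer_shape i.
Proof.
move=> lti; have [_ _ strong _ _] := profile_strong pP.
have := strong i ltac:(lia); rewrite -!/(x _) => /andP[+ _]; rewrite stepE.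
by case/and4P => ? ? ? ?; split; rewrite ?cE ?aE ?sE //; lia.
Qed.

Let inner_exchange i : i.+2 < k ->
  [/\ c i.+1 + a i.+1 <= a i + c i.+2, a i.+1 + s i.+1 <= s i + a i.+2
    & s i.+1 + s i.+1 <= s i + s i.+2].
Proof.
move=> lti; have [_ _ _ exch _] := profile_strong pP.
have := exch i ltac:(lia); rewrite -!/(x _) exchangeE.
by case/and3P => ? ? ?; split; rewrite ?cE ?aE ?sE //; lia.
Qed.

Let inner_state i : i < k -> gorenstein_state (a i, s i).
Proof.
move=> lti; rewrite aE // sE // -surjective_pairing.
case: i lti => [|i] lti //; have [_ _ strong _ _] := profile_strong pP.
by have /andP[] := strong i ltac:(lia).
Qed.

Let tail_facts :
  [/\ [/\ a k <= a k.-1, a k <= s k.-1, a k.+1 <= a k, c k.+2 <= c k.+1 & c k.+3 <= c k.+2],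
      [/\ two_variable_shape [:: c k.-1; a k.-1 - c k; s k.-1 - a k; a k.-1 - a k; c k.-1 - c k],
          two_variable_shape [:: c k; a k - c k.+1; a k - a k.+1; c k - c k.+1],
          two_variable_shape [:: c k.+1; a k.+1 - c k.+2; c k.+1 - c k.+2]
        & two_variable_shape [:: c k.+2; c k.+2 - c k.+3]],
      [/\ c k.-1 + a k.-1 <= a k.-2 + c k, a k.-1 + s k.-1 <= s k.-2 + a k
        & c k + a k <= a k.-1 + c k.+1]
    & [/\ a k + a k <= s k.-1 + a k.+1, c k.+1 + a k.+1 <= a k + c k.+2
        & c k.+2 + c k.+2 <= a k.+1 + c k.+3]].
Proof.
have [[ck ck1 ck2 ck3] [ak ak1]] := tailE.
have [_ _ _ _] := profile_strong pP; rewrite -!/(x _) (_ : k.-2.+1 = k.-1); last by lia.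
rewrite ck ck1 ck2 ck3 ak ak1 !(cE, aE, sE); try lia.
case: (x k.-2) (x k.-1) => a0 s0 [a1 s1].
by case/and3P => /and5P[? ? ? ? ?] /and4P[? ? ? ?] /and5P[? ? ? ? /andP[? ?]].
Qed.
Let M := profile_matrix k p.
Let entryM u v : entry M u v = layered k G u v.
Proof. exact: entry_layer. Qed.

(** M decreases along layers and, by [beside], increases when moving to the next
    layer on the previous diagonal: this gives all row and column comparisons. *)
Let below d i : d < 3 -> i.+1 + 2 * d <= k.+3 -> G d i.+1 <= G d i.
Proof.
have [[t1 t2 t3 t4 t5] _ _ _] := tail_facts.
have [lti|lei] := ltnP i.+1 k.
  have [h1 h2 _ _] := inner_shape lti.
  case: d => [|[|[|//]]] _ _ //.
  by rewrite -!/(c _) !c_pos; lia.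
case: d => [|[|[|//]]] _ le_i.
- rewrite -!/(c _); have [->|[->|[->|->]]] : i = k.-1 \/ i = k \/ i = k.+1 \/ i = k.+2 by lia.
  + by rewrite (_ : k.-1.+1 = k) ?c_pos; lia.
  + by rewrite !c_pos; lia.
  + by [].
  + by [].
- rewrite -!/(a _); have [->|->] : i = k.-1 \/ i = k by lia.
  + by rewrite (_ : k.-1.+1 = k) //; lia.
  + by [].
by lia.
Qed.

Let beside d i : d < 2 -> i + 2 * d + 2 <= k.+3 -> G d i.+1 <= G d.+1 i.
Proof.
have [[t1 t2 t3 t4 t5] _ _ _] := tail_facts.
have pos_le i' : i' < k -> a i' <= s i'.
  by move=> lt; move: (inner_state lt); rewrite /gorenstein_state !inE => /or4P[|||/or4P[|||/orP[]]] /eqP[-> ->].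
case: d => [|[|//]] _ le_i.
  rewrite -/(c _) -/(a _); have [lei|lti] := leqP i.+1 k.+1; last first.
    have -> : i = k.+1 by lia.
    by apply: (leq_trans t4); rewrite c_pos //; lia.
  by rewrite c_pos //; have := @below 1 i isT ltac:(lia); rewrite -!/(a _); lia.
rewrite -/(a _) -/(s _); have := @below 1 i isT ltac:(lia); rewrite -!/(a _) => le_a.
by apply: (leq_trans le_a); apply: pos_le; lia.
Qed.

Let entry_row u v : u <= v -> entry M u v.+1 <= entry M u v.
Proof.
move=> le_uv; rewrite !entryM; have [ltv|] := ltnP v.+1 k.+4; last first.
  by move=> leu; rewrite {1}/layered ifF //; lia.
have [le|lt] := leqP u (k.+3 - v.+1).
  rewrite (@layered_at k G u v.+1 (minn 2 u) (v - u).+1) ?(@layered_at k G u v (minn 2 u) (v - u)); try lia.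
  by apply: below; lia.
have [le2|lt2] := leqP 2 (k.+3 - v.+1).
  rewrite (@layered_at k G u v.+1 2 (v - u).+1) ?(@layered_at k G u v 2 (v - u)); try lia.
  by apply: below; lia.
rewrite (@layered_at k G u v.+1 (k.+3 - v.+1) (v - u).+1); try lia.
rewrite (@layered_at k G u v (k.+3 - v.+1).+1 (v - u)); try lia.
by apply: beside; lia.
Qed.

Let entry_column u v : u < v -> entry M u v <= entry M u.+1 v.
Proof.
move=> lt_uv; rewrite !entryM; have [ltv|] := ltnP v k.+4; last first.
  by move=> leu; rewrite {1}/layered ifF //; lia.
have Ei : v - u = (v - u.+1).+1 by lia.
have [le|lt] := leqP (k.+3 - v) u.
  rewrite (@layered_at k G u v (minn 2 (k.+3 - v)) (v - u)) ?(@layered_at k G u.+1 v (minn 2 (k.+3 - v)) (v - u.+1)); try lia.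
  by rewrite Ei; apply: below; lia.
have [le2|lt2] := leqP 2 u.
  rewrite (@layered_at k G u v 2 (v - u)) ?(@layered_at k G u.+1 v 2 (v - u.+1)); try lia.
  by rewrite Ei; apply: below; lia.
rewrite (@layered_at k G u v u (v - u)) ?(@layered_at k G u.+1 v u.+1 (v - u.+1)); try lia.
by rewrite Ei; apply: beside; lia.
Qed.

Let kp : k.-1.+1 = k. Proof. by lia. Qed.
Let k2 : k.-2.+1 = k.-1. Proof. by lia. Qed.

Let exch0 i : i <= k -> c i.+1 + a i.+1 <= a i + c i.+2.
Proof.
have [_ _ [t1 _ t2] [_ t3 _]] := tail_facts; move=> lei.
have [lti|] := ltnP i.+2 k; first by have [] := inner_exchange lti.
move=> lek; have [->|[->|->]] : i = k.-2 \/ i = k.-1 \/ i = k by lia.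
- by rewrite k2 kp.
- by rewrite kp.
- by [].
Qed.

Let exch1 i : i.+1 < k -> a i.+1 + s i.+1 <= s i + a i.+2.
Proof.
have [_ _ [_ t1 _] _] := tail_facts; move=> lei.
have [lti|] := ltnP i.+2 k; first by have [] := inner_exchange lti.
move=> lek; have -> : i = k.-2 by lia.
by rewrite k2 kp.
Qed.

(** For e >= 2 all the entries are on the plateau, that is on layer 2. *)
Let exch_deep e i : i.+1 + 2 * e + 2 <= k.+3 ->
  G (minn 2 e) i.+1 + G (minn 2 e.+1) i.+1 <= G (minn 2 e.+1) i + G (minn 2 e) i.+2.
Proof.
case: e => [|[|e]] le_i.
- by rewrite -!/(c _) -!/(a _); apply: exch0; lia.
- by rewrite -!/(s _) -!/(a _); apply: exch1; lia.
- have [m2 m3] : minn 2 e.+2 = 2 /\ minn 2 e.+3 = 2 by lia.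
  by rewrite m2 m3 -!/(s _); have [_ _] := @inner_exchange i ltac:(lia).
Qed.

(** On the antidiagonal of symmetry the two entries of the left-hand side lie on the
    same layer. *)
Let exch_middle e i : i.+1 + 2 * e + 1 = k.+3 ->
  G (minn 2 e) i.+1 + G (minn 2 e) i.+1 <= G (minn 2 e.+1) i + G (minn 2 e) i.+2.
Proof.
have [_ _ _ [t1 _ t2]] := tail_facts.
case: e => [|[|e]] le_i.
- by rewrite -!/(c _) -!/(a _) (_ : i = k.+1) //; lia.
- rewrite -!/(s _) -!/(a _) (_ : i = k.-1); last by lia.
  by rewrite kp.
- have [m2 m3] : minn 2 e.+2 = 2 /\ minn 2 e.+3 = 2 by lia.
  by rewrite m2 m3 -!/(s _); have [_ _] := @inner_exchange i ltac:(lia).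
Qed.

Let entry_exchange u v : u < v -> v < k.+3 ->
  entry M u v + entry M u.+1 v.+1 <= entry M u.+1 v + entry M u v.+1.
Proof.
move=> lt_uv ltv; rewrite !entryM; have [i Ei] : exists i, v = u + i.+1 by exists (v - u).-1; lia.
have at_ u' v' d j : v' = u' + j -> v' < k.+4 -> minn 2 (minn u' (k.+3 - v')) = d ->
  layered k G u' v' = G d j by apply: layered_at.
have [le|lt] := leqP (u + 2) (k.+3 - v).
  rewrite (at_ u v (minn 2 u) i.+1) ?(at_ u.+1 v.+1 (minn 2 u.+1) i.+1)
    ?(at_ u.+1 v (minn 2 u.+1) i) ?(at_ u v.+1 (minn 2 u) i.+2); try lia.
  by apply: exch_deep; lia.
have [Eu|ne] := eqVneq (u + 1) (k.+3 - v).
  rewrite (at_ u v (minn 2 u) i.+1) ?(at_ u.+1 v.+1 (minn 2 u) i.+1)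
    ?(at_ u.+1 v (minn 2 u.+1) i) ?(at_ u v.+1 (minn 2 u) i.+2); try lia.
  by apply: exch_middle; lia.
pose e := k.+2 - v.
rewrite (at_ u v (minn 2 e.+1) i.+1) ?(at_ u.+1 v.+1 (minn 2 e) i.+1)
    ?(at_ u.+1 v (minn 2 e.+1) i) ?(at_ u v.+1 (minn 2 e) i.+2); try lia.
by rewrite addnC; apply: exch_deep; lia.
Qed.

Let layer_zero i : i < k.+4 -> c i = 0 ->
  forall d, d < 3 -> i + 2 * d <= k.+3 -> G d i = 0.
Proof.
move=> lti ci; have a0 : i <= k.+1 -> a i = 0.
  by move=> lei; move: ci; rewrite c_pos //; lia.
case=> [|[|[|//]]] _ lei; [exact: ci | by rewrite -/(a i) a0 //; lia |].
have := inner_state (i := i) ltac:(lia); rewrite -/(s i) a0; last by lia.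
by rewrite /gorenstein_state !inE !xpair_eqE /= orbF => /eqP.
Qed.

Let layer_one i : i < k.+4 -> c i <= 1.
Proof.
have [[_ _ _ t4 t5] _ _ _] := tail_facts.
move=> lti; have [lei|lek] := leqP i k.+1; first by rewrite c_pos //; case: (0 < a i).
have : c k.+1 <= 1 by rewrite c_pos //; case: (0 < _).
by have [->|->] : i = k.+2 \/ i = k.+3; lia.
Qed.

(** On the short diagonals the value s is never reached, so any admissible s will
    do; a itself, or 1, is taken. *)
Let layer_pair i : i < k.+4 -> c i = 1 ->
  exists ab : nat * nat, [/\ gorenstein_pair ab.1 ab.2,
    (2 < k.+3 - i) || (ab.1 == ab.2) && ((0 < k.+3 - i) || (ab.2 == 1))
    & forall d, i + 2 * d <= k.+3 -> G (minn 2 d) i = nth ab.2 [:: 1; ab.1] d].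
Proof.
move=> lti ci.
have small q : 0 < q <= 3 -> gorenstein_pair q q by case: q => [|[|[|[|]]]].
have a_le q : q <= k -> a q.+1 <= a q by move=> leq; apply: below; lia.
have a3 q : q <= k.+1 -> a q <= 3.
  elim: q => [|q IHq] leq; first by rewrite aE //; lia.
  by have := IHq ltac:(lia); have := a_le q ltac:(lia); lia.
have [ltk|lek] := ltnP i k.
  exists (a i, s i); split=> [|/=|[|[|d]] led /=]; rewrite ?nth_nil //.
    have := inner_state ltk; rewrite /gorenstein_state in_cons => /orP[/eqP [a0 _]|//].
    by move: ci; rewrite c_pos ?a0 //; lia.
    by rewrite (_ : 2 < _) //; lia.
  by rewrite (_ : minn 2 d.+2 = 2) //; lia.
have [lek1|gtk1] := leqP i k.+1.
  have a_gt0 : 0 < a i by move: ci; rewrite c_pos //; lia.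
  exists (a i, a i); split=> [|/=|[|[|d]] led //=].
  - by apply: (small (a i)); rewrite a_gt0 a3.
  - by rewrite eqxx /=; lia.
  - by lia.
exists (1, 1); split=> // [|[|d] led]; [by rewrite /= orbT orbT | by [] | by lia].
Qed.

Let sT : size T = k.+4 := size_T1361 k.

Let profile_diagonal i : i < size T ->
  all (fun q => q == 0) (diagonal M i) \/ AG_sequence3 F ((size T).-1 - i) (diagonal M i).
Proof.
rewrite {1}sT => lti.
have nthD u : u < k.+4 - i ->
    nth 0 (diagonal M i) u = G (minn 2 (minn u (k.+3 - i - u))) i.
  move=> ltu; rewrite nth_diagonal ifT ?sT // entryM.
  by apply: layered_at; first [by [] | by congr (minn 2 (minn _ _)); lia | lia].
have [c0|c_gt0] := posnP (c i).
  left; apply/(all_nthP 0) => u; rewrite size_mkseq => ltu.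
  have ltu' : u < k.+4 - i by rewrite -sT.
  by rewrite nthD // layer_zero //; lia.
right; have ci : c i = 1 by have := layer_one lti; lia.
have [[a' s'] /= [as_ok e_ok GE]] := layer_pair lti ci.
have := AG_sequence_pair F as_ok e_ok; rewrite (_ : (size T).-1 - i = k.+3 - i); last by rewrite sT.
congr AG_sequence3; apply: (@eq_from_nth _ 0).
  rewrite size_mkseq; have -> : size (diagonal M i) = size T - i by apply: size_mkseq.
  by rewrite sT; lia.
move=> u; rewrite size_mkseq => ltu; rewrite nth_mkseq // nthD; last by lia.
by rewrite GE //; lia.
Qed.

Let entry_above_le u i : entry_above M u (u + i) <= entry M u (u + i).
Proof. by case: u => // u; apply: entry_column; lia. Qed.

Definition profile_difference i u := entry M u (u + i) - entry_above M u (u + i).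

Let differenceE u i d d' : u.+1 + i < k.+4 -> minn 2 (minn u.+1 (k.+3 - (u.+1 + i))) = d ->
    minn 2 (minn u (k.+3 - (u.+1 + i))) = d' ->
    profile_difference i u.+1 = G d i - G d' i.+1.
Proof.
move=> ltu Ed Ed'; rewrite /profile_difference /= !entryM.
by rewrite (layered_at _ (erefl _) ltu Ed) (layered_at _ (addSnnS u i) ltu Ed').
Qed.

Let difference0 i : i < k.+4 -> profile_difference i 0 = c i.
Proof. by move=> lti; rewrite /profile_difference /= subn0 entryM (@layered_at k G 0 _ 0 i) //; lia. Qed.

Let profile_difference_shape i : i < k.+4 ->
  two_variable_shape (mkseq (profile_difference i) (k.+4 - i)).
Proof.
have [_ [wg1 wg2 wg3 wg4] _ _] := tail_facts.
move=> lti; have [ltk|lek] := ltnP i.+1 k.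
  have [_ _ _] := inner_shape ltk; move/(@shape_insert (k - i).-2).
  congr (is_true (two_variable_shape _)).
  rewrite /mkseq (_ : k.+4 - i = 3 + ((k - i).-2.+1 + 2)); last by lia.
  rewrite !iotaD !map_cat.
  have -> : [seq profile_difference i u | u <- iota (0 + 3) (k - i).-2.+1] =
      nseq (k - i).-2.+1 (s i - s i.+1).
    rewrite -[X in nseq X _](size_iota 3) -(size_map (profile_difference i)).
    apply/all_pred1P/allP => _ /mapP[[|u] + ->]; rewrite mem_iota // => ltu.
    by rewrite /= (@differenceE u i 2 2) //; lia.
  congr (_ :: _); first by rewrite difference0.
  congr (_ :: _); first by rewrite (@differenceE 0 i 1 0) //; lia.
  congr (_ :: _); first by rewrite (@differenceE 1 i 2 1) //; lia.
  congr (_ :: (_ ++ _)); rewrite /= !add0n !add3n.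
  have -> : (k - i).-2.+4 = (k.+1 - i).+1 by lia.
  congr [:: _; _].
    by rewrite (@differenceE _ i 1 1) //; lia.
  by rewrite (@differenceE _ i 0 0) //; lia.
have diffE u q d d' : u.+1 + q < k.+4 -> minn 2 (minn u.+1 (k.+3 - (u.+1 + q))) = d ->
    minn 2 (minn u (k.+3 - (u.+1 + q))) = d' ->
    profile_difference q u.+1 = G d q - G d' q.+1 by apply: differenceE.
have [->|[->|[->|[->|->]]]] :
  i = k.-1 \/ i = k \/ i = k.+1 \/ i = k.+2 \/ i = k.+3 by lia.
- rewrite (_ : k.+4 - k.-1 = 5) /mkseq /=; last by lia.
  rewrite difference0 ?(diffE 0 k.-1 1 0) ?(diffE 1 k.-1 2 1) ?(diffE 2 k.-1 1 1)
    ?(diffE 3 k.-1 0 0) ?kp //; lia.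
- rewrite (_ : k.+4 - k = 4) /mkseq /=; last by lia.
  by rewrite difference0 ?(diffE 0 k 1 0) ?(diffE 1 k 1 1) ?(diffE 2 k 0 0) //; lia.
- rewrite (_ : k.+4 - k.+1 = 3) /mkseq /=; last by lia.
  by rewrite difference0 ?(diffE 0 k.+1 1 0) ?(diffE 1 k.+1 0 0) //; lia.
- rewrite (_ : k.+4 - k.+2 = 2) /mkseq /=; last by lia.
  by rewrite difference0 ?(diffE 0 k.+2 0 0) //; lia.
rewrite (_ : k.+4 - k.+3 = 1) /mkseq /=; last by lia.
have := layer_one (leqnn k.+4); rewrite difference0 // /two_variable_shape /=.
by case: (c k.+3) => [|[|]].
Qed.

Let entry_plateau u v : u <= v -> v < k.+4 -> 1 < minn u (k.+3 - u) ->
  1 < minn v (k.+3 - v) -> entry M u v = G 2 (v - u).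
Proof. by move=> *; rewrite entryM (@layered_at k G u v 2 (v - u)) //; lia. Qed.

Lemma profile_matrix_potential : potential_rank_matrix F T M.
Proof.
have ltT (u : 'I_(size T)) : u < k.+4 by rewrite -sT.
have T6 (u : 'I_(size T)) : nth 0 T u = \max_(t <- T) t -> 1 < minn u (k.+3 - u).
  rewrite max_T1361; last by lia.
  by rewrite nth_T1361 //; case: (minn _ _) => [|[|]].
have [c0 a0 s0] : [/\ c 0 = 1, a 0 = 3 & s 0 = 6].
  by rewrite cE ?aE ?sE //; lia.
have a1 : 0 < a 1 by have [_ + _ _ _] := profile_strong pP; rewrite aE //; lia.
split.
- by move=> u v lt_vu; rewrite mxE /layered ifF //; lia.
- apply: (@eq_from_nth _ 0) => [|u]; first by rewrite size_mkseq subn0.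
  have -> : size (diagonal M 0) = size T - 0 by apply: size_mkseq.
  rewrite subn0 nth_diagonal subn0 addn0 => ltu; rewrite ltu entryM.
  rewrite sT in ltu; rewrite nth_T1361 // (@layered_at k G u u (minn 2 (minn u (k.+3 - u))) 0) //; last by lia.
  case: (minn u _) => [|[|d]] //=; first by rewrite nth_nil (_ : minn 2 d.+2 = 2) //; lia.
- apply/(has_nthP 0); exists 1; first by rewrite size_mkseq sT; lia.
  rewrite nth_diagonal ifT; last by rewrite sT; lia.
  by rewrite entryM (@layered_at k G 1 _ 1 1) -?lt0n //; lia.
- exact: profile_diagonal.
- move=> i; rewrite {1}sT => lti.
  have -> : diagonal_difference M i = [seq q%:Z | q <- mkseq (profile_difference i) (k.+4 - i)]%R.
    have size_diff : size (diagonal_difference M i) = size T - i by apply: size_mkseq.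
    apply: (@eq_from_nth _ 0%R) => [|u]; rewrite size_diff.
      by rewrite size_map size_mkseq sT.
    move=> ltu; rewrite nth_diagonal_difference //.
    rewrite sT in ltu; rewrite (nth_map 0) ?size_mkseq // nth_mkseq //.
    by rewrite /profile_difference -subzn ?entry_above_le.
  exact/O_sequence_shape/profile_difference_shape.
- move=> u v v' le_uv le_vv'; rewrite -!entryE -(subnKC le_vv').
  elim: (v' - v) => [|q IHq]; first by rewrite addn0.
  by rewrite addnS; apply: leq_trans IHq; apply: entry_row; lia.
- move=> u u' v le_uu' le_u'v; rewrite -!entryE.
  have : exists q, u' = u + q :> nat by exists (u' - u); lia.
  case=> q Eq; rewrite Eq in le_u'v *; elim: q {Eq} le_u'v => [|q IHq] le_v.
    by rewrite addn0.
  by apply: leq_trans (IHq _) _; [lia | rewrite addnS; apply: entry_column; lia].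
- move=> u v lt_uv; rewrite {1}sT => ltv; exact: entry_exchange.
move=> u v u' v' le_uv le_uv' Ei /T6 Tu /T6 Tv /T6 Tu' /T6 Tv'.
rewrite -!entryE (entry_plateau le_uv (ltT v) Tu Tv).
by rewrite (entry_plateau le_uv' (ltT v') Tu' Tv') Ei.
Qed.

End Sufficient.

(** * Jordan degree types and the count *)

Local Open Scope nat_scope.

Lemma jordan_degree_type_mult n (M : 'M[nat]_n) u v : u <= v < n ->
  jordan_degree_type M ((v - u).+1, u) = string_multiplicity M u v.
Proof.
move=> uv; set q := (_, _).
have evalD (A B : multiset (nat * nat)%type) : (msetD A B) q = A q + B q by rewrite msetE2.
have eval0 : (mset0 : multiset (nat * nat)%type) q = 0 by rewrite mset0E.
rewrite /jordan_degree_type (big_morph _ evalD eval0).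
rewrite (bigD1_seq u) ?mem_index_iota ?iota_uniq //=; last by lia.
rewrite [X in _ + X]big1 ?addn0 => [|u' u'u]; last first.
  rewrite (big_morph _ evalD eval0) big1 // => v' _.
  by rewrite msetnE xpair_eqE [u == u']eq_sym (negPf u'u) andbF.
rewrite (big_morph _ evalD eval0) (bigD1_seq v) ?mem_index_iota ?iota_uniq //=.
rewrite msetnE eqxx big_nat_cond big1 ?addn0 // => v' /andP[uv' v'v].
by rewrite msetnE xpair_eqE eqxx andbT ifF //; lia.
Qed.

(** The multiplicity of the string from u to v is the mixed second difference of
    the entries at (u, v), (u-1, v), (u, v+1), (u-1, v+1), without truncation by the
    second hypothesis.  Going down the rows, and leftwards in each row, it
    determines the entry at (u, v) from the others. *)
Lemma rank_matrix_of_jordan_type n (M M' : 'M[nat]_n) :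
  (forall N, N = M \/ N = M' ->
    (forall u v : 'I_n, v < u -> N u v = 0) /\
    (forall u v, u <= v < n ->
      entry_above N u v + entry N u v.+1 <= entry N u v + entry_above N u v.+1)) ->
  jordan_degree_type M = jordan_degree_type M' -> M = M'.
Proof.
move=> hyp eqJ; have [up exact_] := hyp _ (or_introl erefl).
have [up' exact_'] := hyp _ (or_intror erefl).
have entry_low (N : 'M[nat]_n) (upN : forall u v : 'I_n, v < u -> N u v = 0) u v :
    ~~ (u <= v < n) -> entry N u v = 0.
  move=> out; have [/andP[ltu ltv]|] := boolP ((u < n) && (v < n)); last exact: entry_default.
  rewrite -[u]/(nat_of_ord (Ordinal ltu)) -[v]/(nat_of_ord (Ordinal ltv)) entryE upN //=.
  by lia.
suff eqE : forall u v, entry M u v = entry M' u v.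
  by apply/matrixP => u v; rewrite -!entryE.
have recover w v : (forall v', entry_above M w v' = entry_above M' w v') ->
    entry M w v = entry M' w v.
  move=> above; move Ed: (n - v) => d; elim: d v Ed => [|d IHd] v Ed.
    by rewrite !entry_low //; lia.
  have [wv|out] := boolP (w <= v < n); last by rewrite !entry_low.
  have := jordan_degree_type_mult M wv; rewrite eqJ jordan_degree_type_mult //.
  have := exact_ _ _ wv; have := exact_' _ _ wv.
  by rewrite /string_multiplicity !above (IHd v.+1); lia.
by elim=> [|u IHu] v; apply: recover.
Qed.

Lemma potential_rank_matrix_exact (F : fieldType) (S : seq nat) (M : 'M[nat]_(size S)) :
  potential_rank_matrix F S M -> forall u v, u <= v < size S ->
  entry_above M u v + entry M u v.+1 <= entry M u v + entry_above M u v.+1.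
Proof.
move=> pM u v /andP[le_uv ltv]; case: u le_uv => [|u] le_uv /=.
  by rewrite addn0; apply: (entry_row pM).
have [ltv1|lev1] := ltnP v.+1 (size S); last first.
  rewrite !(entry_default _ (v := v.+1)) ?addn0; try by rewrite [v.+1 < _]ltnNge lev1 andbF.
  exact: (entry_column pM).
by apply: (prm_exchange pM); lia.
Qed.

Lemma jordan_degree_type_inj (F : fieldType) (S : seq nat) (M M' : 'M[nat]_(size S)) :
  potential_rank_matrix F S M -> potential_rank_matrix F S M' ->
  jordan_degree_type M = jordan_degree_type M' -> M = M'.
Proof.
move=> pM pM'; apply: rank_matrix_of_jordan_type => N [->|->].
  by split; [exact: (prm_upper pM) | exact: (potential_rank_matrix_exact pM)].
by split; [exact: (prm_upper pM') | exact: (potential_rank_matrix_exact pM')].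
Qed.

Section Counting.
Variables (F : fieldType) (k : nat) (k5 : 5 <= k).
Local Notation T := (T1361 k).

Lemma potential_rank_matrixP (M : 'M[nat]_(size T)) :
  M \in [seq profile_matrix k p | p <- profiles k.-2] <-> potential_rank_matrix F T M.
Proof.
split=> [/mapP[[w [[[b0 b1] b2] b3]] pin ->]|pM].
  exact: profile_matrix_potential.
by apply/mapP; exists (profile_of M); [exact: (profile_of_in k5 pM) | exact: (profile_matrix_of k5 pM)].
Qed.

(** The profile is read off the rows 0, 1 and 2 of the matrix. *)
Lemma profile_matrix_inj : {in profiles k.-2 &, injective (profile_matrix k)}.
Proof.
move=> [w [[[b0 b1] b2] b3]] [w' [[[b0' b1'] b2'] b3']] pin pin' eqM.
have [sw _ _ _ _] := profile_strong pin; have [sw' _ _ _ _] := profile_strong pin'.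
have eqL d i : d < 3 -> i + 2 * d <= k.+3 ->
    profile_layer (w, (b0, b1, b2, b3)) d i = profile_layer (w', (b0', b1', b2', b3')) d i.
  move=> ltd lei; have := congr1 (fun M => entry M d (d + i)) eqM.
  by rewrite /= !entry_layer !(@layered_at k _ d _ d i) //; lia.
have k1 : k.-2.+2 = k by lia.
have -> : w = w'.
  apply: (@eq_from_nth _ start) => [|i]; first by rewrite sw sw'.
  rewrite sw => lti; have := eqL 1 i.+1 isT ltac:(lia); have := eqL 2 i.+1 isT ltac:(lia).
  rewrite !profile_layer2 ?profile_layer1 ?sw ?sw' // lti /=.
  by case: (nth _ w i) (nth _ w' i) => ? ? [? ?] /= -> ->.
have := eqL 1 k isT ltac:(lia); have := eqL 1 k.+1 isT ltac:(lia).
have := eqL 0 k.+2 isT ltac:(lia); have := eqL 0 k.+3 isT ltac:(lia).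
rewrite !profile_layer0 !profile_layer1 sw sw' k1 !ifF ?subnn ?subSnn; try lia.
by rewrite -!(addn3 k) -!(addn2 k) !addKn /= => -> -> -> ->.
Qed.

End Counting.

Theorem theorem3p9 (F : fieldType) (hF : infinite_field F)
    (k : nat) (hk : (5 <= k)%N) :
  has_exactly 65
    (fun J : multiset (nat * nat)%type =>
       potential_jordan_degree_type F (T1361 k) J) /\
  has_exactly 65
    (fun M : 'M[nat]_(size (T1361 k)) => potential_rank_matrix F (T1361 k) M).
Proof.
pose Ms := [seq profile_matrix k p | p <- profiles k.-2].
have Ms_uniq : uniq Ms.
  rewrite map_inj_in_uniq ?profiles_uniq //; exact: profile_matrix_inj.
have Ms_size : size Ms = 65 by rewrite size_map size_profiles //; lia.
have MsP := potential_rank_matrixP F hk.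
split; last by exists Ms.
exists [seq jordan_degree_type M | M <- Ms]; split; last 1 first.
- move=> J; split=> [/mapP[M /MsP pM ->]|[M /MsP MMs ->]]; first by exists M.
  exact: map_f.
- rewrite map_inj_in_uniq // => M M' /MsP pM /MsP pM'.
  exact: (jordan_degree_type_inj pM pM').
- by rewrite size_map.
Qed.
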